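(* Let $M$ be a hypermodular matroid of rank $4$ with a finite or countably infinite ground set. Then $M$ is embeddable in an OTE matroid $\overline{M}$ of rank $4$ such that the restriction to $E(M)$ of any line of $\overline{M}$ is a line of $M$, and furthermore: (i) $\overline{M}$ is finite if and only if $M$ is finite; (ii) for every $p\in E(M)$, the simplification of $\overline{M}/p$ is isomorphic to the simplification of $M/p$; (iii) if $M$ satisfies the bundle condition, then $\overline{M}$ is modular.
   Context: Lines and planes are flats of rank $2$ and $3$; two lines are coplanar if their union has rank $3$. A pair $(X,Y)$ of flats is modular if $\operatorname{rk}(X)+\operatorname{rk}(Y)=\operatorname{rk}(X\cup Y)+\operatorname{rk}(X\cap Y)$; a matroid is modular if all pairs of flats are modular and hypermodular if all pairs of hyperplanes are modular. A modular cut is a set of flats closed under flat supersets and under intersections of members forming a modular pair; it is principal if it equals $\{G\text{ flat}: G\supseteq F\}$ for some flat $F$; a matroid is OTE if every nonempty modular cut is principal. $M$ embeds in $\overline{M}$ if $M$ is a restriction of $\overline{M}$. A matroid of rank at least $4$ satisfies the bundle condition if for any four disjoint lines $l_1,\dots,l_4$, no three of them coplanar, whenever five of the six pairs $(l_i,l_j)$ are coplanar then all six pairs are coplanar.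
   Formalization: When M has loops, (ii) is claimed only for elements p that are not loops, and ''disjoint lines'' in the bundle condition means lines whose intersection has rank 0; for loopless M this is the statement as given. *)

(* Defs.v *)
From HB Require Import structures.
From mathcomp Require Import all_boot.
From mathcomp Require Import boolp classical_sets functions cardinality.

Set Implicit Arguments.
Unset Strict Implicit.
Unset Printing Implicit Defensive.

Local Open Scope classical_set_scope.
Local Open Scope card_scope.

(** Matroids of finite rank on a possibly infinite ground set, given by their
    rank function.  [rk_finitary] is automatic when the ground set is finite.
    As a normalization, [rk] is defined on all sets of the carrier type and
    ignores the elements outside the ground set. *)
Record matroid (T : Type) := Matroid {
  ground : set T;
  rk : set T -> nat;
  rk_ground : forall X, rk (X `&` ground) = rk X;
  rk_card : forall X n, X #= `I_n -> rk X <= n;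
  rk_mono : forall X Y, X `<=` Y -> rk X <= rk Y;
  rk_submod : forall X Y, rk (X `|` Y) + rk (X `&` Y) <= rk X + rk Y;
  rk_finitary : forall X, exists F, [/\ finite_set F, F `<=` X & rk F = rk X]
}.

Lemma rk_card_of1 (T : Type) (r : set T -> nat) :
    r set0 = 0 -> (forall x, r [set x] <= 1) ->
    (forall X Y, r (X `|` Y) + r (X `&` Y) <= r X + r Y) ->
  forall X n, X #= `I_n -> r X <= n.
Proof.
move=> r0 r1 rU X n; elim: n X => [|n IHn] X.
  by rewrite II0 card_eq0 => /eqP ->; rewrite r0.
move=> /eq_cardSP[x Xx /IHn rXx]; rewrite -(setD1K Xx).
apply: leq_trans (leq_trans (leq_addr _ _) (rU _ _)) _.
by rewrite -[n.+1]add1n; apply: leq_add.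
Qed.

Lemma rk0 (T : Type) (M : matroid T) : rk M set0 = 0.
Proof. by apply/eqP; rewrite -leqn0; apply: rk_card; rewrite II0 card_eq00. Qed.

Lemma rk_set1 (T : Type) (M : matroid T) (x : T) : rk M [set x] <= 1.
Proof. by apply: rk_card; apply: card_set1. Qed.

Section MatroidNotions.
Context {T : Type} (M : matroid T).
Implicit Types (X Y F H L : set T) (C : set (set T)).

Definition rank : nat := rk M (ground M).

Definition flat F : Prop :=
  F `<=` ground M /\
  forall e, ground M e -> ~ F e -> rk M F < rk M (e |` F).

Definition point F : Prop := flat F /\ rk M F = 1.
Definition line F : Prop := flat F /\ rk M F = 2.
Definition hyperplane F : Prop := flat F /\ (rk M F).+1 = rank.

Definition modular_pair X Y : Prop :=
  rk M X + rk M Y = rk M (X `|` Y) + rk M (X `&` Y).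

Definition modular : Prop :=
  forall X Y, flat X -> flat Y -> modular_pair X Y.

Definition hypermodular : Prop :=
  forall X Y, hyperplane X -> hyperplane Y -> modular_pair X Y.

Definition modular_cut C : Prop :=
  [/\ forall F, C F -> flat F,
      forall F G, C F -> flat G -> F `<=` G -> C G
    & forall F G, C F -> C G -> modular_pair F G -> C (F `&` G)].

Definition principal C : Prop :=
  exists2 F, flat F & C = [set G | flat G /\ F `<=` G].

Definition OTE : Prop :=
  forall C, modular_cut C -> C !=set0 -> principal C.

Definition coplanar L1 L2 : Prop := rk M (L1 `|` L2) = 3.
Definition coplanar3 L1 L2 L3 : Prop := rk M (L1 `|` L2 `|` L3) = 3.

(** Every flat contains all the loops, so disjointness of flats is understood
    modulo loops; without loops this is [X `&` Y = set0]. *)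
Definition disjoint_flats X Y : Prop := rk M (X `&` Y) = 0.

(** The six pairs of lines are indexed by the pairs [i < j] in ['I_4]. *)
Definition bundle_condition : Prop :=
  forall l : 'I_4 -> set T,
    (forall i, line (l i)) ->
    (forall i j : 'I_4, i < j -> disjoint_flats (l i) (l j)) ->
    (forall i j k : 'I_4, i < j -> j < k -> ~ coplanar3 (l i) (l j) (l k)) ->
    (exists a b : 'I_4, a < b /\
       forall i j : 'I_4, i < j -> (i, j) <> (a, b) -> coplanar (l i) (l j)) ->
    forall i j : 'I_4, i < j -> coplanar (l i) (l j).

End MatroidNotions.

Section Restriction.
Context {T : Type} (M : matroid T) (A : set T).

Definition restrict_rk (X : set T) : nat := rk M (X `&` A).

Fact restrict_ground X : restrict_rk (X `&` (ground M `&` A)) = restrict_rk X.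
Proof.
rewrite /restrict_rk -[RHS]rk_ground; congr (rk M _).
by rewrite setIA -setIA setIid [RHS]setIAC.
Qed.

Fact restrict_mono X Y : X `<=` Y -> restrict_rk X <= restrict_rk Y.
Proof. by move=> XY; apply: rk_mono; apply: setSI. Qed.

Fact restrict_submod X Y :
  restrict_rk (X `|` Y) + restrict_rk (X `&` Y)
    <= restrict_rk X + restrict_rk Y.
Proof. by rewrite /restrict_rk setIUl setIIl; apply: rk_submod. Qed.

Fact restrict_card X n : X #= `I_n -> restrict_rk X <= n.
Proof.
by move=> Xn; apply: leq_trans (rk_card M Xn); apply: rk_mono => x [].
Qed.

Fact restrict_finitary X :
  exists F, [/\ finite_set F, F `<=` X & restrict_rk F = restrict_rk X].
Proof.
have [F [finF FXA rF]] := rk_finitary M (X `&` A); exists F; split=> //.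
  by move=> x /FXA[].
rewrite /restrict_rk -rF; congr (rk M _); apply/setIidPl.
by move=> x /FXA[].
Qed.

Definition restrict : matroid T :=
  @Matroid T (ground M `&` A)
    restrict_rk restrict_ground restrict_card restrict_mono restrict_submod
    restrict_finitary.

End Restriction.

Section Contraction.
Context {T : Type} (M : matroid T) (A : set T).

Definition contract_rk (X : set T) : nat := rk M (X `|` A) - rk M A.

Let leA X : rk M A <= rk M (X `|` A).
Proof. by apply: rk_mono; apply: subsetUr. Qed.

Fact contract_ground X : contract_rk (X `&` (ground M `\` A)) = contract_rk X.
Proof.
rewrite /contract_rk; congr (_ - _); rewrite -[LHS]rk_ground -[RHS]rk_ground.
congr (rk M _); apply/seteqP; split=> x /=; first by tauto.
by have := EM (A x); tauto.
Qed.

Fact contract_mono X Y : X `<=` Y -> contract_rk X <= contract_rk Y.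
Proof. by move=> XY; apply: leq_sub2r; apply: rk_mono; apply: setSU. Qed.

Fact contract_submod X Y :
  contract_rk (X `|` Y) + contract_rk (X `&` Y)
    <= contract_rk X + contract_rk Y.
Proof.
rewrite /contract_rk -(leq_add2r (rk M A + rk M A)).
rewrite [leqLHS]addnACA [leqRHS]addnACA !subnK //.
have := rk_submod M (X `|` A) (Y `|` A).
by rewrite -setUIl setUACA setUid.
Qed.

Fact contract_card X n : X #= `I_n -> contract_rk X <= n.
Proof.
apply: rk_card_of1 X n => [|x|]; last exact: contract_submod.
  by rewrite /contract_rk set0U subnn.
rewrite /contract_rk leq_subLR; have := rk_submod M [set x] A.
move=> /(leq_trans (leq_addr _ _)) /leq_trans; apply.
by rewrite addnC leq_add2l rk_set1.
Qed.

Fact contract_finitary X :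
  exists F, [/\ finite_set F, F `<=` X & contract_rk F = contract_rk X].
Proof.
have [F [finF FXA rF]] := rk_finitary M (X `|` A).
exists (F `&` X); split; [exact: finite_setIl | exact: subIsetr |].
apply/eqP; rewrite eqn_leq contract_mono ?andTb; last exact: subIsetr.
rewrite /contract_rk -rF; apply: leq_sub2r; apply: rk_mono => x Fx.
by have [Xx|Ax] := FXA _ Fx; [left|right].
Qed.

Definition contract : matroid T :=
  @Matroid T (ground M `\` A)
    contract_rk contract_ground contract_card contract_mono contract_submod
    contract_finitary.

End Contraction.

(** The simplification of [M] is taken on the set of its points, so that no
    choice of representatives of the parallel classes is needed. *)
Section Simplification.
Context {T : Type} (M : matroid T).

Definition simplify_rk (C : set (set T)) : nat :=
  rk M (\bigcup_(P in C `&` point M) P).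

Fact simplify_ground C :
  simplify_rk (C `&` [set P | point M P]) = simplify_rk C.
Proof. by rewrite /simplify_rk -setIA setIid. Qed.

Fact simplify_mono C D : C `<=` D -> simplify_rk C <= simplify_rk D.
Proof. by move=> CD; apply: rk_mono; apply: bigcup_subset; apply: setSI. Qed.

Fact simplify_submod C D :
  simplify_rk (C `|` D) + simplify_rk (C `&` D)
    <= simplify_rk C + simplify_rk D.
Proof.
rewrite /simplify_rk setIUl bigcup_setU; apply: leq_trans (rk_submod _ _ _).
rewrite leq_add2l; apply: rk_mono => x [P [[CP DP] pP] Px].
by split; exists P.
Qed.

Fact simplify_card C n : C #= `I_n -> simplify_rk C <= n.
Proof.
apply: rk_card_of1 C n => [|P|]; last exact: simplify_submod.
  by rewrite /simplify_rk set0I bigcup_set0 rk0.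
have [pP|nP] := EM (point M P).
  by case: (pP) => _ <-; apply: rk_mono => x [_ [-> _]].
rewrite [simplify_rk _](_ : _ = 0)// -(rk0 M); congr (rk M _).
by rewrite -subset0 => x [_ [-> /nP]].
Qed.

Fact simplify_finitary C :
  exists D, [/\ finite_set D, D `<=` C & simplify_rk D = simplify_rk C].
Proof.
have [F [finF FC rF]] := rk_finitary M (\bigcup_(P in C `&` point M) P).
have /choice[h hP] : forall x, exists P,
    F x -> (C `&` point M) P /\ P x.
  move=> x.
  have [/FC[P CP Px]|nFx] := EM (F x); first by exists P.
  by exists set0 => /nFx.
exists (h @` F); split; first exact: finite_image.
  by move=> _ [x Fx <-]; have [[]] := hP _ Fx.
apply/eqP; rewrite eqn_leq simplify_mono ?andTb; last first.
  by move=> _ [x Fx <-]; have [[]] := hP _ Fx.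
rewrite /simplify_rk -rF; apply: rk_mono => x Fx.
have [[_ ph] hx] := hP _ Fx.
by exists (h x) => //; split=> //; exists x.
Qed.

Definition simplify : matroid (set T) :=
  @Matroid (set T) [set P | point M P]
    simplify_rk simplify_ground simplify_card simplify_mono simplify_submod
    simplify_finitary.

End Simplification.

Definition isomorphism {T U : Type} (M : matroid T) (N : matroid U)
    (f : T -> U) : Prop :=
  set_bij (ground M) (ground N) f /\
  forall X, X `<=` ground M -> rk N (f @` X) = rk M X.

Definition isomorphic {T U : Type} (M : matroid T) (N : matroid U) : Prop :=
  exists f : T -> U, isomorphism M N f.

(** [f] identifies [M] with a restriction of [N]. *)
Definition embedding {T U : Type} (M : matroid T) (N : matroid U)
    (f : T -> U) : Prop :=
  f @` ground M `<=` ground N /\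
  isomorphism M (restrict N (f @` ground M)) f.

(* Main.v *)
(** The new points of [N] are all the nonprincipal modular cuts of [M].  In a
    hypermodular matroid of rank 4, the lines of such a cut are pairwise
    disjoint and coplanar and cover [M], so the cut behaves like the set of
    flats through a missing point.  Any two such cuts share a line (the
    intersection of two planes, each spanned by a line of either cut through a
    common point), so all of them can be added at once, without creating new
    lines or planes.  A nonprincipal modular cut of [N] would trace on [M] a
    nonprincipal modular cut, whose point already lies on all its lines.
    Finally, the bundle condition says precisely that two disjoint coplanar
    lines of [M] lie in a nonprincipal modular cut. *)

Require Import Defs.
From mathcomp Require Import all_boot zify.
From mathcomp Require Import boolp classical_sets functions cardinality.

Set Implicit Arguments.
Unset Strict Implicit.
Unset Printing Implicit Defensive.

Local Open Scope classical_set_scope.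
Local Open Scope card_scope.

(** A set of old and new points is encoded by the family of flats of [M] above it, which is a
    nonempty modular cut. If this cut is principal, its generator supplies the rank; otherwise the
    cut is itself a new point and the rank is 1. The matroid axioms of the extension thus reduce to
    an invariant [rho] of nonempty modular cuts, which has to drop strictly along strict inclusions
    and to be submodular. Unions of point sets become intersections of cuts, but the cut above an
    intersection is only known to contain the two given cuts; submodularity is therefore proved with
    an arbitrary cut containing both. *)

Lemma finite_powerset (T : Type) (A : set T) :
  finite_set A -> finite_set [set B | B `<=` A].
Proof.
move=> [n]; elim: n A => [|n IHn] A.
  rewrite II0 card_eq0 => /eqP ->; apply: (sub_finite_set _ (finite_set1 set0)).
  by move=> B /=; rewrite subset0.
move=> /eq_cardSP[x Ax /IHn finA].
pose S := [set B | B `<=` A `\ x].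
apply: (@sub_finite_set _ _ (S `|` (fun B => x |` B) @` S)); last first.
  by rewrite finite_setU; split=> //; exact: finite_image.
move=> B BA; have [Bx|nBx] := EM (B x).
  right; exists (B `\ x); last exact: setD1K.
  by move=> y [/BA].
by left=> y By; split; [exact: BA|move=> yx; apply: nBx; rewrite -yx].
Qed.

(** * Flats and modular cuts *)

Section MatroidTheory.
Context {T : Type} (M : matroid T).
Implicit Types (X Y Z F G : set T) (C D : set (set T)).

Lemma rkUZ X Y Z : Z `<=` X -> Z `<=` Y ->
  rk M (X `|` Y) + rk M Z <= rk M X + rk M Y.
Proof.
move=> ZX ZY; apply: leq_trans (rk_submod M X Y); rewrite leq_add2l.
by apply: rk_mono => x Zx; split; [exact: ZX|exact: ZY].
Qed.

Lemma rkU_le X Y : rk M (X `|` Y) <= rk M X + rk M Y.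
Proof. exact: leq_trans (leq_addr _ _) (rk_submod M X Y). Qed.

Lemma rkU1_le e X : rk M (e |` X) <= (rk M X).+1.
Proof. by have := rkU_le [set e] X; have := rk_set1 M e; lia. Qed.

(** Finitariness replaces [Y] by a finite set, whose elements are then absorbed one at a time by
    submodularity. *)
Lemma rk_absorb X Y :
  (forall e, Y e -> rk M (e |` X) = rk M X) -> rk M (X `|` Y) = rk M X.
Proof.
move=> YX; apply/eqP; rewrite eqn_leq [X in _ && X]rk_mono ?andbT;
  last exact: subsetUl.
have [F [finF FXY <-]] := rk_finitary M (X `|` Y).
have {FXY} FX e : F e -> rk M (e |` X) = rk M X.
  move=> /FXY[Xe|/YX//]; congr (rk M _).
  by apply/seteqP; split=> x /=; [case=> [->|]|right].
suff: rk M (X `|` F) <= rk M X.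
  by apply: leq_trans; apply: rk_mono; apply: subsetUr.
have [n Fn] := finF.
elim: n F Fn FX {finF} => [|n IHn] F.
  by rewrite II0 card_eq0 => /eqP -> _; rewrite setU0.
move=> /eq_cardSP[x Fx /IHn IH] FX.
have /IH{IH} : forall e, (F `\ x) e -> rk M (e |` X) = rk M X.
  by move=> e [/FX].
have := FX _ Fx.
have := @rkUZ (X `|` (F `\ x)) (x |` X) X (@subsetUl _ _ _) (@subsetUr _ _ _).
rewrite [X in rk M X + _ <= _](_ : _ = X `|` F); first lia.
apply/seteqP; split=> y /=.
  by case=> [[|[]]|[->|]]; tauto.
by case: (EM (y = x)); tauto.
Qed.

Lemma flat_sub F : flat M F -> F `<=` ground M. Proof. by case. Qed.

Lemma flat_rkU1 F e : flat M F -> ground M e -> ~ F e ->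
  rk M (e |` F) = (rk M F).+1.
Proof. by case=> _ h ge /(h _ ge); have := rkU1_le e F; lia. Qed.

Lemma flat_ground : flat M (ground M). Proof. by split. Qed.

Lemma flat_eq F G : flat M F -> F `<=` G -> G `<=` ground M ->
  rk M G <= rk M F -> F = G.
Proof.
move=> fF FG GE rGF; apply/seteqP; split=> // e Ge; apply: contrapT => nFe.
have := flat_rkU1 fF (GE _ Ge) nFe.
suff : rk M (e |` F) <= rk M G by lia.
by apply: rk_mono => x [->|/FG].
Qed.

Lemma flat_rkU F Y : flat M F -> Y `<=` ground M -> ~ Y `<=` F ->
  rk M F < rk M (F `|` Y).
Proof.
move=> fF YE /existsNP[e /not_implyP[Ye nFe]].
rewrite -(flat_rkU1 fF (YE _ Ye) nFe).
by apply: rk_mono => x [->|]; [right|left].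
Qed.

Lemma flat_cap F G : flat M F -> flat M G -> flat M (F `&` G).
Proof.
move=> fF fG; split=> [x [Fx _]|e ge nFG]; first exact: flat_sub fF _ Fx.
wlog nFe : F G fF fG nFG / ~ F e.
  move=> W; have [Fe|] := EM (F e); last by move=> ?; apply: W.
  rewrite setIC; apply: W => //; first by rewrite setIC.
  by move=> Ge; apply: nFG.
have := flat_rkU1 fF ge nFe.
have := @rkUZ (e |` (F `&` G)) F (F `&` G) (@subsetUr _ _ _) (@subIsetl _ _ _).
suff : rk M (e |` F) <= rk M ((e |` (F `&` G)) `|` F) by lia.
by apply: rk_mono => x /=; tauto.
Qed.

Definition cl X : set T := [set e | ground M e /\ rk M (e |` X) = rk M X].

Lemma cl_ground X : cl X `<=` ground M. Proof. by move=> x []. Qed.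

Lemma subI_cl X : X `&` ground M `<=` cl X.
Proof.
move=> x [Xx Ex]; split=> //.
by congr (rk M _); apply/setUidPr => _ ->.
Qed.

Lemma sub_cl X : X `<=` ground M -> X `<=` cl X.
Proof. by move=> XE x Xx; apply: subI_cl; split=> //; apply: XE. Qed.

Lemma rk_cl X : rk M (cl X) = rk M X.
Proof.
apply/eqP; rewrite eqn_leq; apply/andP; split.
  rewrite -(@rk_absorb X (cl X)) => [|e []//].
  by apply: rk_mono; apply: subsetUr.
by rewrite -rk_ground; apply: rk_mono; apply: subI_cl.
Qed.

Lemma flat_cl X : flat M (cl X).
Proof.
split=> [|e Ee nXe]; first exact: cl_ground.
rewrite rk_cl ltnNge; apply/negP => le; apply: nXe; split=> //.
apply/eqP; rewrite eqn_leq [X in _ && X]rk_mono ?andbT; last by move=> ?; right.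
apply: leq_trans le; rewrite -rk_ground; apply: rk_mono => x [].
by case=> [->|Xx] Ex; [left|right; apply: subI_cl].
Qed.

Lemma cl_min X F : flat M F -> X `<=` F -> cl X `<=` F.
Proof.
move=> fF XF e [Ee eX]; apply: contrapT => nFe.
have := flat_rkU1 fF Ee nFe.
have := @rkUZ (e |` X) F X (@subsetUr _ _ _) XF.
suff : rk M (e |` F) <= rk M ((e |` X) `|` F) by lia.
by apply: rk_mono => x /=; tauto.
Qed.

Lemma cl_setI X : cl (X `&` ground M) = cl X.
Proof.
have eX e : ground M e -> rk M (e |` (X `&` ground M)) = rk M (e |` X).
  move=> Ee; rewrite -[LHS]rk_ground -[RHS]rk_ground; congr (rk M _).
  by apply/seteqP; split=> y /=; tauto.
by apply/seteqP; split=> e [Ee rX]; split=> //; move: rX;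
  rewrite eX// rk_ground.
Qed.

Lemma subset_cl X Y : X `<=` Y -> Y `<=` ground M -> cl X `<=` cl Y.
Proof.
move=> XY YE; apply: cl_min; first exact: flat_cl.
exact: subset_trans XY (sub_cl YE).
Qed.

Lemma nonloop_in X : 0 < rk M X -> exists2 x, X x & rk M [set x] = 1.
Proof.
move=> rX; apply: contrapT => nX.
suff : rk M (set0 `|` X) = rk M set0 by rewrite set0U rk0; lia.
apply: rk_absorb => e Xe; rewrite setU0 rk0.
apply/eqP; rewrite -leqn0 leqNgt; apply/negP => re; apply: nX; exists e => //.
by have := rk_set1 M e; lia.
Qed.

Lemma nonloop_ground x : rk M [set x] = 1 -> ground M x.
Proof.
move=> rx; apply: contrapT => nEx; move: rx.
rewrite -rk_ground (_ : _ `&` _ = set0) ?rk0//.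
by rewrite -subset0 => _ [->].
Qed.

Lemma notin_of_rk X : rk M X < rank M -> exists2 x, ground M x & ~ X x.
Proof.
move=> rX; apply: contrapT => nX.
suff : rank M <= rk M X by lia.
apply: rk_mono => x Ex; apply: contrapT => nXx; apply: nX; by exists x.
Qed.

Lemma modular_pair_sub X Y : X `<=` Y -> modular_pair M X Y.
Proof. by move=> XY; rewrite /modular_pair (setUidPr _ _).2// (setIidl XY)
  addnC. Qed.

Lemma modular_pairC X Y : modular_pair M X Y -> modular_pair M Y X.
Proof. by rewrite /modular_pair setUC setIC addnC. Qed.

Lemma modular_pair_rk1 X Y : X `<=` ground M -> flat M Y -> rk M X <= 1 ->
  modular_pair M X Y.
Proof.
move=> XE fY rX; have [/modular_pair_sub//|XY] := EM (X `<=` Y).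
have := flat_rkU fY XE XY; have := rk_submod M X Y.
rewrite /modular_pair setUC; lia.
Qed.

Lemma rk0_sub Z F : flat M F -> Z `<=` ground M -> rk M Z = 0 -> Z `<=` F.
Proof.
move=> fF ZE rZ; apply: contrapT => ZF.
by have := flat_rkU fF ZE ZF; have := rkU_le F Z; lia.
Qed.

Definition up F : set (set T) := [set G | flat M G /\ F `<=` G].

Lemma up_refl F : flat M F -> up F F. Proof. by split. Qed.

Lemma up_cut F : modular_cut M (up F).
Proof.
split=> [G []//|G H [fG FG] fH GH|G H [fG FG] [fH FH] _].
  by split=> //; apply: subset_trans GH.
by split; [exact: flat_cap|rewrite subsetI].
Qed.

Lemma principal_up F : flat M F -> principal M (up F).
Proof. by exists F. Qed.

Lemma cut_flat C F : modular_cut M C -> C F -> flat M F.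
Proof. by case=> h _ _; apply: h. Qed.

Lemma cut_up C F : modular_cut M C -> C F -> up F `<=` C.
Proof. by case=> _ h _ CF G [fG]; apply: h. Qed.

Lemma cut_cap C F G : modular_cut M C -> C F -> C G -> modular_pair M F G ->
  C (F `&` G).
Proof. by case=> _ _; apply. Qed.

Lemma principalP C F : modular_cut M C -> C F -> (forall G, C G -> F `<=` G) ->
  C = up F.
Proof.
move=> mC CF CFG; apply/seteqP; split; last exact: cut_up.
by move=> G CG; split; [exact: cut_flat CG|exact: CFG].
Qed.

Lemma cut_rk0 C F : modular_cut M C -> C F -> rk M F = 0 -> C = up F.
Proof.
move=> mC CF rF; have fC G := @cut_flat C G mC.
by apply: principalP => // G /fC fG; apply: rk0_sub => //; case: (fC _ CF).
Qed.

Lemma cut_rk1_rk0 C F G : modular_cut M C -> C F -> rk M F <= 1 -> C G ->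
  ~ F `<=` G -> C (F `&` G) /\ rk M (F `&` G) = 0.
Proof.
move=> mC CF rF CG FG; have fC G' := @cut_flat C G' mC.
have mFG : modular_pair M F G.
  by apply: modular_pair_rk1 => //; [case: (fC _ CF)|exact: fC].
split; first exact: cut_cap.
have := flat_rkU (fC _ CG) (flat_sub (fC _ CF)) FG.
by move: mFG; rewrite /modular_pair setUC; lia.
Qed.

(** A flat of rank at most 1 is modular with every flat. Either it lies in all members of the cut,
    or its intersection with some member is a flat of rank 0, which lies in every flat and generates
    the cut. *)
Lemma cut_rk1 C F : modular_cut M C -> C F -> rk M F <= 1 -> principal M C.
Proof.
move=> mC CF rF; have fC G := @cut_flat C G mC.
have [[G CG FG]|nG] := EM (exists2 G, C G & ~ F `<=` G).
  have [CFG rFG] := cut_rk1_rk0 mC CF rF CG FG.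
  by rewrite (cut_rk0 mC CFG rFG); apply/principal_up/fC.
rewrite (principalP mC CF) => [|G CG]; first exact/principal_up/fC.
by apply: contrapT => FG; apply: nG; exists G.
Qed.

End MatroidTheory.

(** * Nonprincipal modular cuts *)

Section Bundles.
Context {T : Type} (M : matroid T).
Implicit Types (X Y Z F G H l m : set T) (C D : set (set T)).

(** These are the new points; the name recalls the bundle of lines through a point. *)
Definition bundle C := [/\ modular_cut M C, C !=set0 & ~ principal M C].

Lemma flat_spanned X F : flat M F -> X `<=` F -> rk M F <= rk M X -> F = cl M X.
Proof.
move=> fF XF rF; apply/esym/(flat_eq (flat_cl M X)); first exact: cl_min.
  exact: flat_sub.
by rewrite rk_cl.
Qed.

(** Since [l] raises the rank of [F], submodularity leaves at most 1 for the intersection, and the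
    value 1 makes it an equality. *)
Lemma line_meet l F : flat M l -> flat M F -> rk M l = 2 -> ~ l `<=` F ->
  0 < rk M (l `&` F) -> rk M (l `&` F) = 1 /\ modular_pair M l F.
Proof.
move=> fl fF rl lF r0.
have := flat_rkU fF (flat_sub fl) lF; have := rk_submod M l F.
by rewrite /modular_pair setUC; lia.
Qed.

Lemma line_neq_sub l m : flat M l -> flat M m -> rk M l = 2 -> rk M m = 2 ->
  l <> m -> ~ l `<=` m.
Proof.
move=> fl fm rl rm lm lsm; apply/lm/(flat_eq fl lsm);
  [exact: flat_sub|by rewrite rl rm].
Qed.

Lemma plane_of x l : flat M l -> rk M l = 2 -> ground M x -> ~ l x ->
  [/\ flat M (cl M (x |` l)), rk M (cl M (x |` l)) = 3,
     l `<=` cl M (x |` l) & cl M (x |` l) x].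
Proof.
move=> fl rl Ex lx; rewrite rk_cl (flat_rkU1 fl Ex lx) rl.
have sE : x |` l `<=` ground M by move=> y [->//|]; exact: flat_sub.
by split=> // [|y ly|]; [exact: flat_cl| |]; apply: sub_cl => //; [right|left].
Qed.

Section OneBundle.
Context C (bC : bundle C).

Lemma bundle_flat F : C F -> flat M F.
Proof. by case: bC => -[+ _ _] _ _; apply. Qed.

Lemma bundle_up F G : C F -> flat M G -> F `<=` G -> C G.
Proof. by case: bC => -[_ + _] _ _; apply. Qed.

Lemma bundle_cap F G : C F -> C G -> modular_pair M F G -> C (F `&` G).
Proof. by case: bC => -[_ _ +] _ _; apply. Qed.

Lemma bundle_ground : C (ground M).
Proof.
case: bC => _ [F CF] _; apply: (bundle_up CF); first exact: flat_ground.
exact/flat_sub/bundle_flat.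
Qed.

Lemma bundle_rk F : C F -> 1 < rk M F.
Proof.
move=> CF; rewrite ltnNge; apply/negP => rF; case: bC => mC _; apply.
exact: cut_rk1 CF rF.
Qed.

(** A common nonloop would make the pair modular and put a flat of rank 1 into the bundle. *)
Lemma bundle_meet l F : C l -> C F -> rk M l = 2 -> ~ l `<=` F ->
  rk M (l `&` F) = 0.
Proof.
move=> Cl CF rl lF; apply/eqP; rewrite -leqn0 leqNgt; apply/negP => r0.
have [r1 mlF] := line_meet (bundle_flat Cl) (bundle_flat CF) rl lF r0.
by have := bundle_rk (bundle_cap Cl CF mlF); lia.
Qed.

Lemma bundle_coplanar l m : C l -> C m -> rk M l = 2 -> rk M m = 2 -> l <> m ->
  rk M (l `|` m) = 3.
Proof.
move=> Cl Cm rl rm lm; have fl := bundle_flat Cl; have fm := bundle_flat Cm.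
have lsm := line_neq_sub fl fm rl rm lm.
have r0 := bundle_meet Cl Cm rl lsm.
have := flat_rkU fm (flat_sub fl) lsm; rewrite setUC.
have := rk_submod M l m; have [mlm|] := EM (modular_pair M l m).
  by have := bundle_rk (bundle_cap Cl Cm mlm); lia.
by rewrite /modular_pair; lia.
Qed.

End OneBundle.

(** * Lines of a nonprincipal cut in rank 4 *)

Section Hypermodular.
Context (hypM : hypermodular M) (rM : rank M = 4).

Lemma rkE : rk M (ground M) = 4. Proof. exact: rM. Qed.

Lemma flat_rk4 F : F `<=` ground M -> rk M F <= 4.
Proof. by move=> FE; rewrite -rM; apply: rk_mono. Qed.

Lemma flat_rk4_eq F : flat M F -> 4 <= rk M F -> F = ground M.
Proof.
move=> fF rF; apply: (flat_eq fF (flat_sub fF)) => //.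
by rewrite rkE.
Qed.

(** Every use of hypermodularity goes through this fact: two distinct planes span rank 4 and meet in
    a line. *)
Lemma plane_cap F G : flat M F -> flat M G -> rk M F = 3 -> rk M G = 3 ->
  F <> G -> modular_pair M F G /\ rk M (F `&` G) = 2.
Proof.
move=> fF fG rF rG FG; have mFG : modular_pair M F G.
  by apply: hypM; split=> //; rewrite ?rF ?rG rM.
split=> //; move: mFG; rewrite /modular_pair.
have nGF : ~ G `<=` F.
  by move=> GF; apply/FG/esym/(flat_eq fG GF); [exact: flat_sub|rewrite rF rG].
have := flat_rkU fF (flat_sub fG) nGF.
have := @flat_rk4 (F `|` G);
  rewrite subUset => /(_ (conj (flat_sub fF) (flat_sub fG))).
lia.
Qed.

Section OneBundle.
Context C (bC : bundle C).

(** Without lines, the cut would consist of at most one plane and the ground set, since two planes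
    would contribute their common line; it would be principal. A single line does not generate the
    cut either, so some member [F] misses it. *)
Lemma bundle_lines : exists l m, [/\ C l, C m, rk M l = 2, rk M m = 2 & l <> m].
Proof.
have [mC _ npC] := bC.
have rk34 F : C F -> rk M F <> 2 -> rk M F = 3 \/ F = ground M.
  move=> CF n2; have := bundle_rk bC CF; have fF := bundle_flat bC CF.
  have := flat_rk4 (flat_sub fF) => r4 r1.
  have [r3|r3] := EM (rk M F = 3); [by left|right].
  by apply: flat_rk4_eq => //; lia.
have [l Cl rl] : exists2 l, C l & rk M l = 2.
  apply: contrapT => nl.
  have n2 F : C F -> rk M F <> 2 by move=> CF r2; apply: nl; exists F.
  have [[F CF r3]|n3] := EM (exists2 F, C F & rk M F = 3).
    apply: npC; rewrite (principalP mC CF);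
      first exact/principal_up/(bundle_flat bC).
    move=> G CG; have [r3'|->] := rk34 _ CG (n2 _ CG);
      last exact/flat_sub/(bundle_flat bC).
    have [->//|FG] := EM (F = G).
    have [mp r2] := plane_cap (bundle_flat bC CF) (bundle_flat bC CG) r3 r3' FG.
    by case: (n2 _ (bundle_cap bC CF CG mp)).
  apply: npC; rewrite (principalP mC (bundle_ground bC)).
    exact/principal_up/flat_ground.
  move=> G CG; have [r3'|->//] := rk34 _ CG (n2 _ CG).
  by case: n3; exists G.
have [F CF lF] : exists2 F, C F & ~ l `<=` F.
  apply: contrapT => nF; apply: npC; rewrite (principalP mC Cl).
    exact/principal_up/(bundle_flat bC).
  by move=> G CG; apply: contrapT => lG; apply: nF; exists G.
have fl := bundle_flat bC Cl.
have [r2|n2] := EM (rk M F = 2).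
  by exists l, F; split=> // lF'; apply: lF; rewrite lF'.
have [r3|FE] := rk34 _ CF n2; last by case: lF; rewrite FE; exact: flat_sub.
(* When [F] is a plane, any plane through [l] is a member different from [F] and cuts it in the
   second line. *)
have [x Ex lx] : exists2 x, ground M x & ~ l x by apply: notin_of_rk;
  rewrite rl rM.
have [fP rP lP _] := plane_of fl rl Ex lx.
have CP := bundle_up bC Cl fP lP.
have FP : F <> cl M (x |` l) by move=> FP; apply: lF; rewrite FP.
have [mp r2] := plane_cap (bundle_flat bC CF) fP r3 rP FP.
exists l, (F `&` cl M (x |` l)); split=> //; first exact: bundle_cap.
by move=> ll; apply: lF; rewrite ll; apply: subIsetl.
Qed.

Lemma bundle_line_in H l x : C H -> rk M H = 3 -> C l -> rk M l = 2 ->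
  ~ l `<=` H -> H x -> exists m, [/\ C m, rk M m = 2 & m x].
Proof.
move=> CH rH Cl rl lH Hx.
have [lx|lx] := EM (l x); first by exists l.
have fH := bundle_flat bC CH.
have [fP rP lP Px] := plane_of (bundle_flat bC Cl) rl (flat_sub fH Hx) lx.
have CP := bundle_up bC Cl fP lP.
have HP : H <> cl M (x |` l) by move=> HP; apply: lH; rewrite HP.
have [mp r2] := plane_cap fH fP rH rP HP.
by exists (H `&` cl M (x |` l)); split=> //; exact: bundle_cap.
Qed.

(** Off the plane [H] of two lines [l1], [l2], the plane through [x] and [l1] does not contain [l2],
    and its intersection with the plane through [x] and [l2] serves. A line obtained this way
    through a point off [H] then handles the points of [H]. *)
Lemma bundle_line x : ground M x -> exists m, [/\ C m, rk M m = 2 & m x].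
Proof.
move=> Ex; have [l1 [l2 [C1 C2 r1 r2 l12]]] := bundle_lines.
have f1 := bundle_flat bC C1; have f2 := bundle_flat bC C2.
have uE : l1 `|` l2 `<=` ground M by rewrite subUset; split; exact: flat_sub.
pose H := cl M (l1 `|` l2).
have rH : rk M H = 3 by rewrite rk_cl (bundle_coplanar bC).
have sH : l1 `|` l2 `<=` H by apply: sub_cl.
have CH : C H.
  by apply: (bundle_up bC C1); [exact: flat_cl|move=> y ?; apply: sH; left].
have out y : ground M y -> ~ H y -> exists m, [/\ C m, rk M m = 2 & m y].
  move=> Ey Hy.
  have l1y : ~ l1 y by move=> ?; apply: Hy; apply: sH; left.
  have [fP rP lP Py] := plane_of f1 r1 Ey l1y.
  have CP := bundle_up bC C1 fP lP.
  apply: (bundle_line_in CP rP C2 r2 _ Py) => l2P; apply: Hy.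
  rewrite /H -(@flat_spanned (l1 `|` l2) (cl M (y |` l1)))//.
    by rewrite subUset; split.
  by rewrite rP -rH rk_cl.
have [Hx|] := EM (H x); last exact: out.
have [y Ey Hy] : exists2 y, ground M y & ~ H y by apply: notin_of_rk;
  rewrite rH rM.
have [m [Cm rm my]] := out y Ey Hy.
by apply: (bundle_line_in CH rH Cm rm _ Hx) => /(_ _ my).
Qed.

Lemma bundle_line_out F : flat M F -> ~ C F -> 0 < rk M F ->
  exists l, [/\ C l, rk M l = 2, rk M (l `&` F) = 1, modular_pair M l F &
                rk M (F `|` l) <= (rk M F).+1].
Proof.
move=> fF nCF r0; have [x Fx rx] := nonloop_in r0.
have [l [Cl rl lx]] := bundle_line (flat_sub fF Fx).
have lF : ~ l `<=` F by move=> lF; apply: nCF; exact: (bundle_up bC Cl fF lF).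
have r1 : 0 < rk M (l `&` F) by rewrite -rx; apply: rk_mono => _ ->.
have [r1' ml] := line_meet (bundle_flat bC Cl) fF rl lF r1.
exists l; split=> //; have := rk_submod M l F; rewrite setUC; lia.
Qed.

(** A line of [C] through a nonloop of [F] meets [F] modularly in a flat of rank 1 of [D]. Two lines
    of [C] are disjoint, so some member of [C] misses this flat and cuts it down to rank 0. This is
    what makes a new point an atom of the extension. *)
Lemma bundle_cut_rk0 D F : modular_cut M D -> C `<=` D -> D F -> ~ C F ->
  exists2 Z, D Z & rk M Z = 0.
Proof.
move=> mD CD DF nCF; have fF := cut_flat mD DF.
have r1 G : D G -> rk M G = 1 -> exists2 Z, D Z & rk M Z = 0.
  move=> DG rG; have [l1 [l2 [C1 C2 r1 r2 l12]]] := bundle_lines.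
  have r0 := bundle_meet bC C1 C2 r1
    (line_neq_sub (bundle_flat bC C1) (bundle_flat bC C2) r1 r2 l12).
  have [[Y CY GY]|nY] := EM (exists2 Y, C Y & ~ G `<=` Y).
    have [DZ rZ] := cut_rk1_rk0 mD DG (eq_leq rG) (CD _ CY) GY.
    by exists (G `&` Y).
  suff : rk M G <= rk M (l1 `&` l2) by lia.
  apply: rk_mono => y Gy.
  by split; apply: contrapT => ny; apply: nY;
    [exists l1|exists l2] => // /(_ _ Gy).
have [r0|r0] := posnP (rk M F); first by exists F.
have [l [Cl rl rlF ml _]] := bundle_line_out fF nCF r0.
by apply: (r1 (l `&` F)) => //; apply: (cut_cap mD _ DF ml); apply: CD.
Qed.

End OneBundle.

(** The bound 2 equals the sum of the ranks of two new points, which is what submodularity needs. *)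
Lemma bundles_common C D : bundle C -> bundle D ->
  exists F, [/\ C F, D F & rk M F <= 2].
Proof.
move=> bC bD.
have near x : rk M [set x] = 1 -> exists F, [/\ C F, D F, F x & rk M F <= 3].
  move=> rx; have Ex := nonloop_ground rx.
  have [l [Cl rl lx]] := bundle_line bC Ex.
  have [m [Dm rm mx]] := bundle_line bD Ex.
  have uE : l `|` m `<=` ground M.
    by rewrite subUset; split; apply: flat_sub;
      [exact: bundle_flat Cl|exact: bundle_flat Dm].
  have uc := sub_cl uE; have fc := flat_cl M (l `|` m).
  exists (cl M (l `|` m)); split.
  - by apply: (bundle_up bC Cl) => // y ly; apply: uc; left.
  - by apply: (bundle_up bD Dm) => // y ly; apply: uc; right.
  - by apply: uc; left.
  - rewrite rk_cl; have := @rkUZ _ M l m [set x].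
    by rewrite !sub1set !inE rx rl rm => /(_ lx mx); lia.
have [x _ rx] : exists2 x, ground M x & rk M [set x] = 1.
  by apply: nonloop_in; rewrite rkE.
have [F [CF DF Fx rF]] := near x rx.
have fF := bundle_flat bC CF.
(* A point outside [F] forces the second common flat to differ from the first. *)
have [y Ey Fy] : exists2 y, ground M y & ~ F y by apply: notin_of_rk;
  rewrite rM.
have ry : rk M [set y] = 1.
  apply/eqP; rewrite eqn_leq rk_set1 lt0n; apply/eqP => r0; apply: Fy.
  by apply: (rk0_sub fF _ r0) => // _ ->.
have [G [CG DG Gy rG]] := near y ry.
have [F2|F2] := leqP (rk M F) 2; first by exists F.
have [G2|G2] := leqP (rk M G) 2; first by exists G.
have FG : F <> G by move=> FG; apply: Fy; rewrite FG.
have [mp r2] : modular_pair M F G /\ rk M (F `&` G) = 2.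
  by apply: (plane_cap fF (bundle_flat bC CG) _ _ FG); lia.
by exists (F `&` G); split; [exact: bundle_cap|exact: bundle_cap|lia].
Qed.

End Hypermodular.

End Bundles.

(** * The extension by all nonprincipal modular cuts *)

Section Extension.
Context {T : Type} (M : matroid T).
Context (hypM : hypermodular M) (rM : rank M = 4).
Implicit Types (F G l m : set T) (C D : set (set T)).
Implicit Types (u : T + set (set T)) (X Y : set (T + set (set T))).

(** * The rank of a modular cut *)

Lemma cut_ground C : modular_cut M C -> C !=set0 -> C (ground M).
Proof.
move=> mC [F CF]; apply: (cut_up mC CF); split; first exact: flat_ground.
exact/flat_sub/(cut_flat mC).
Qed.

Definition ncut C := modular_cut M C /\ C !=set0.

Lemma ncut_cap C D : ncut C -> ncut D -> ncut (C `&` D).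
Proof.
move=> [mC nC] [mD nD]; split; last first.
  by exists (ground M); split; exact: cut_ground.
split=> [F [CF _]|F G [CF DF] fG FG|F G [CF DF] [CG DG] mp].
- exact: cut_flat CF.
- by split; [apply: (cut_up mC CF)|apply: (cut_up mD DF)].
- by split; [exact: (cut_cap mC)|exact: (cut_cap mD)].
Qed.

Lemma ncut_up F : flat M F -> ncut (up M F).
Proof. by move=> fF; split; [exact: up_cut|exists F; split]. Qed.

Lemma ncut_bundle C : bundle M C -> ncut C.
Proof. by case. Qed.

Lemma ncutP C : ncut C -> bundle M C \/ exists2 F, flat M F & C = up M F.
Proof.
by move=> [mC nC]; have [[F fF ->]|npC] := EM (principal M C); [right;
  exists F|left].
Qed.

(** The rank in the extension of the flat that lies on all members of [C]: a
    nonprincipal cut stands for a single added point. *)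
Definition rho C : nat :=
  if `[< principal M C >] then rk M (\bigcap_(F in C) F) else 1.

Lemma rho_up F : flat M F -> rho (up M F) = rk M F.
Proof.
move=> fF; rewrite /rho asboolT; last exact: principal_up.
congr (rk M _); apply/seteqP; split=> x; first by apply; split.
by move=> Fx G [_]; apply.
Qed.

Lemma rho_bundle C : bundle M C -> rho C = 1.
Proof. by case=> _ _ np; rewrite /rho asboolF. Qed.

Lemma rho_rk0 C F : ncut C -> C F -> rk M F = 0 -> rho C = 0.
Proof.
move=> [mC _] CF rF; rewrite (cut_rk0 mC CF rF) rho_up//.
exact: cut_flat CF.
Qed.

(** Above a bundle the value falls from 1 to 0; a principal cut inside a bundle has a generator of
    rank at least 2; two principal cuts compare as their generators do. *)
Lemma rho_lt C D : ncut C -> ncut D -> C `<=` D -> C <> D -> rho D < rho C.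
Proof.
move=> nC nD CD nCD.
have DC : ~ D `<=` C by move=> DC; apply: nCD; apply/seteqP.
case: (ncutP nC) => [bC|[F fF CE]].
  move: DC => /existsNP[G /not_implyP[DG nCG]].
  have [Z DZ rZ] := bundle_cut_rk0 hypM rM bC nD.1 CD DG nCG.
  by rewrite (rho_bundle bC) (rho_rk0 nD DZ rZ).
have DF : D F by apply: CD; rewrite CE; exact: up_refl.
case: (ncutP nD) => [bD|[G fG DE]].
  by rewrite (rho_bundle bD) CE rho_up//; apply: (bundle_rk bD).
rewrite CE DE !rho_up//; move: DF; rewrite DE => -[_ GF].
rewrite ltnNge; apply/negP => rGF; apply: nCD; rewrite CE DE; congr (up M _).
exact/esym/(flat_eq fG GF (flat_sub fF) rGF).
Qed.

Lemma rho_mono C D : ncut C -> ncut D -> C `<=` D -> rho D <= rho C.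
Proof.
move=> nC nD CD; have [->//|nCD] := EM (C = D).
exact/ltnW/rho_lt.
Qed.

Lemma rho_le C F : ncut C -> C F -> rho C <= rk M F.
Proof.
move=> nC CF; have fF := cut_flat nC.1 CF.
rewrite -rho_up//; apply: rho_mono => //; first exact: ncut_up.
exact: cut_up nC.1 CF.
Qed.

(** Comparable cuts are settled by monotonicity. For two principal cuts, the span of the generators
    bounds the first term. If [C] is a bundle, [G] strictly contains it and has [rho] 0, so a common
    member of [C] and [D] of small rank is enough: a shared line if [D] is a bundle, otherwise the
    span of the generator of [D] and a line of [C] meeting it in a point. *)
Lemma rho_submod C D (G : set (set T)) : ncut C -> ncut D -> ncut G ->
  C `<=` G -> D `<=` G ->
  rho (C `&` D) + rho G <= rho C + rho D.
Proof.
wlog CD : C D / bundle M C \/ (exists2 F, flat M F & C = up M F) /\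
                               exists2 F, flat M F & D = up M F.
  move=> W nC nD; case: (ncutP nC) => [bC|pC]; first by apply: W; auto.
  case: (ncutP nD) => [bD|pD]; last by apply: W; auto.
  by move=> nG CG DG; rewrite setIC addnC [leqRHS]addnC addnC; apply: W; auto.
move=> nC nD nG CG DG; have nCD := ncut_cap nC nD.
have [sCD|nsCD] := EM (C `<=` D).
  by rewrite (setIidl sCD) leq_add2l; exact: rho_mono.
have [sDC|nsDC] := EM (D `<=` C).
  by rewrite (setIidr sDC) addnC leq_add2r; exact: rho_mono.
case: CD => [bC|[[F fF CE] [H fH DE]]]; last first.
  have GF : G F by apply: CG; rewrite CE; exact: up_refl.
  have GH : G H by apply: DG; rewrite DE; exact: up_refl.
  have uE : F `|` H `<=` ground M by rewrite subUset; split; exact: flat_sub.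
  have : rho (C `&` D) <= rk M (F `|` H).
    rewrite -rk_cl; apply: rho_le => //; rewrite CE DE.
    by split; (split; [exact: flat_cl|]);
      apply: subset_trans (sub_cl uE); [exact: subsetUl|exact: subsetUr].
  rewrite CE DE !rho_up//.
  have [mp|nmp] := EM (modular_pair M F H).
    have := rho_le nG (cut_cap nG.1 GF GH mp).
    by move: mp; rewrite /modular_pair; lia.
  (* A non-modular pair has slack in the submodular inequality, which pays for
     the possible new point of rank 1 on both flats. *)
  move: nmp (rk_submod M F H); rewrite /modular_pair.
  case: (ncutP nG) => [bG|[K fK GE]]; first by rewrite (rho_bundle bG); lia.
  suff : rho G <= rk M (F `&` H) by lia.
  rewrite GE rho_up//; apply: rk_mono; rewrite subsetI.
  by move: GF GH; rewrite GE => -[_ ?] [_ ?].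
have [F DF nCF] : exists2 F, D F & ~ C F.
  by move: nsDC => /existsNP[F /not_implyP[DF nCF]]; exists F.
have [Z GZ rZ] := bundle_cut_rk0 hypM rM bC nG.1 CG (DG _ DF) nCF.
rewrite (rho_rk0 nG GZ rZ) (rho_bundle bC) addn0.
case: (ncutP nD) => [bD|[H fH DE]].
  have [K [CK DK rK]] := bundles_common hypM rM bC bD.
  by rewrite (rho_bundle bD); apply: leq_trans (rho_le nCD _) rK.
have nCH : ~ C H by move=> CH; apply: nsDC; rewrite DE; exact: cut_up nC.1 CH.
have [rH|rH] := posnP (rk M H).
  case: nsCD => K CK; have fK : flat M K by exact: bundle_flat CK.
  by rewrite DE; split=> //; exact: (rk0_sub fK (flat_sub fH) rH).
have [l [Cl rl _ _ rHl]] := bundle_line_out hypM rM bC fH nCH rH.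
rewrite DE rho_up// -DE add1n; apply: leq_trans rHl; rewrite -rk_cl.
have uE : H `|` l `<=` ground M.
  by rewrite subUset; split; apply: flat_sub => //; exact: bundle_flat Cl.
apply: rho_le => //; split.
  apply: (bundle_up bC Cl); first exact: flat_cl.
  by apply: subset_trans (sub_cl uE); exact: subsetUr.
rewrite DE; split; first exact: flat_cl.
by apply: subset_trans (sub_cl uE); exact: subsetUl.
Qed.

(** * The matroid on old and new points *)

Definition flats_through u : set (set T) :=
  match u with inl e => [set F | flat M F /\ F e] | inr C => C end.

Definition ext_ground : set (T + set (set T)) :=
  [set u | match u with inl e => ground M e | inr C => bundle M C end].

(** The guard [ext_ground u] makes the rank ignore elements outside the ground set, as the
    normalization of [matroid] demands. *)
Definition flats_above X : set (set T) :=
  [set F | flat M F /\ forall u, X u -> ext_ground u -> flats_through u F].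

Lemma ncut_through u : ext_ground u -> ncut (flats_through u).
Proof.
case: u => [e|C] /= gu; last exact: ncut_bundle.
split; last by exists (ground M); split=> //; exact: flat_ground.
split=> [F []//|F G [fF Fe] fG FG|F G [fF Fe] [fG Ge] _].
  by split=> //; exact: FG.
by split=> //; exact: flat_cap.
Qed.

Lemma ncut_above X : ncut (flats_above X).
Proof.
split; last first.
  exists (ground M); split=> [|u _ gu]; first exact: flat_ground.
  by have [? ?] := ncut_through gu; exact: cut_ground.
split=> [F []//|F G [fF XF] fG FG|F G [fF XF] [fG XG] mp].
  split=> // u Xu gu; have [mu _] := ncut_through gu.
  by apply: (cut_up mu (XF _ Xu gu)).
split=> [|u Xu gu]; first exact: flat_cap.
by have [mu _] := ncut_through gu; apply: (cut_cap mu _ _ mp); auto.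
Qed.

Lemma aboveU X Y : flats_above (X `|` Y) = flats_above X `&` flats_above Y.
Proof.
apply/seteqP; split=> F.
  by move=> [fF XYF]; split; split=> // u ? ?; apply: XYF => //; [left|right].
by move=> [[fF XF] [_ YF]]; split=> // u [?|?] ?; [exact: XF|exact: YF].
Qed.

Lemma aboveS X Y : X `<=` Y -> flats_above Y `<=` flats_above X.
Proof. by move=> XY F [fF YF]; split=> // u /XY; exact: YF. Qed.

Definition ext_rk X : nat := rho (flats_above X).

Fact ext_rk_ground X : ext_rk (X `&` ext_ground) = ext_rk X.
Proof.
congr rho; apply/seteqP; split=> F [fF XF]; split=> // u; first by move=> *;
  exact: XF.
by move=> [Xu _]; exact: XF.
Qed.

Fact ext_rk_mono X Y : X `<=` Y -> ext_rk X <= ext_rk Y.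
Proof. by move=> XY; apply: rho_mono; [exact: ncut_above..|exact: aboveS]. Qed.

Fact ext_rk_submod X Y :
  ext_rk (X `|` Y) + ext_rk (X `&` Y) <= ext_rk X + ext_rk Y.
Proof.
rewrite /ext_rk aboveU; apply: rho_submod; [exact: ncut_above..| |].
  exact: aboveS (@subIsetl _ _ _).
exact: aboveS (@subIsetr _ _ _).
Qed.

Lemma above_inl (Z : set T) : flats_above (inl @` Z) = up M (cl M Z).
Proof.
apply/seteqP; split=> F [fF ZF]; split=> //.
  rewrite -cl_setI; apply: cl_min => // x [Zx Ex].
  have Zx' : (inl @` Z) (inl x : T + set (set T)) by exists x.
  exact: (ZF (inl x) Zx' Ex).2.
by move=> _ [x Zx <-] /= Ex; split=> //; apply: ZF; exact: subI_cl.
Qed.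

Lemma ext_rk_inl (Z : set T) : ext_rk (inl @` Z) = rk M Z.
Proof. by rewrite /ext_rk above_inl rho_up ?rk_cl//; exact: flat_cl. Qed.

Fact ext_rk_card X n : X #= `I_n -> ext_rk X <= n.
Proof.
apply: rk_card_of1 X n => [|u|]; last exact: ext_rk_submod.
  by have := ext_rk_inl set0; rewrite image_set0 rk0.
have [gu|gu] := EM (ext_ground u); last first.
  rewrite -ext_rk_ground (_ : _ `&` _ = inl @` set0) ?ext_rk_inl ?rk0//.
  by rewrite image_set0 -subset0 => _ [->].
case: u gu => [e _|C bC]; first by rewrite -image_set1 ext_rk_inl;
  exact: rk_set1.
rewrite -(rho_bundle bC); apply: rho_mono;
  [exact: ncut_bundle|exact: ncut_above|].
by move=> F CF; split=> [|_ -> _//]; exact: bundle_flat CF.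
Qed.

Lemma ext_rk_le4 X : ext_rk X <= 4.
Proof.
rewrite -(rkE rM); apply: rho_le; first exact: ncut_above.
by have [? ?] := ncut_above X; exact: cut_ground.
Qed.

Lemma above_eq X Y : X `<=` Y -> ext_rk Y <= ext_rk X ->
  flats_above X = flats_above Y.
Proof.
move=> XY rYX; apply: contrapT => nXY.
have := rho_lt (ncut_above Y) (ncut_above X) (aboveS XY) (nesym nXY).
by rewrite -/(ext_rk X) -/(ext_rk Y); lia.
Qed.

(** A finite subset of maximal rank exists because ranks are at most 4. By strictness of [rho],
    adding any point of [X] to it leaves the cut above it unchanged. *)
Fact ext_rk_finitary X :
  exists Y, [/\ finite_set Y, Y `<=` X & ext_rk Y = ext_rk X].
Proof.
pose P n := `[< exists Y, [/\ finite_set Y, Y `<=` X & ext_rk Y = n] >].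
have exP : exists n, P n.
  by exists (ext_rk set0); apply/asboolP; exists set0; split.
have ubP n : P n -> n <= 4 by move=> /asboolP[Y [_ _ <-]]; exact: ext_rk_le4.
case: (ex_maxnP exP ubP) => n /asboolP[Y [finY YX rY]] nmax.
exists Y; split=> //.
have YE u : X u -> flats_above (u |` Y) = flats_above Y.
  move=> Xu; apply/esym/above_eq; first by move=> ? ?; right.
  rewrite rY; apply: nmax; apply/asboolP; exists (u |` Y); split=> //.
    by rewrite finite_setU.
  by move=> v [->|/YX].
apply/eqP; rewrite eqn_leq ext_rk_mono// andTb; apply: rho_mono.
- exact: ncut_above.
- exact: ncut_above.
move=> G YG; split=> [|u Xu gu]; first by case: YG.
by move: YG; rewrite -(YE _ Xu) => -[_]; apply=> //; left.
Qed.

Definition extension : matroid (T + set (set T)) :=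
  @Matroid (T + set (set T))%type ext_ground ext_rk ext_rk_ground ext_rk_card
    ext_rk_mono ext_rk_submod ext_rk_finitary.

Notation N := extension.

(** * Flats of the extension *)

Definition ext_flat F : set (T + set (set T)) :=
  [set u | ext_ground u /\ flats_through u F].

Lemma ext_flat_inl F : flat M F -> inl @` F `<=` ext_flat F.
Proof. by move=> fF _ [x Fx <-]; split=> //=; exact: flat_sub Fx. Qed.

Lemma above_ext_flat F : flat M F -> flats_above (ext_flat F) = up M F.
Proof.
move=> fF; apply/seteqP; split.
  move=> G /(aboveS (ext_flat_inl fF)); rewrite above_inl => -[fG FG].
  by split=> //; apply: subset_trans FG; apply/sub_cl/flat_sub.
apply: (cut_up (ncut_above _).1); split=> // u [gu Fu] _; exact: Fu.
Qed.

Lemma rk_ext_flat F : flat M F -> rk N (ext_flat F) = rk M F.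
Proof. by move=> fF; rewrite /= /ext_rk above_ext_flat// rho_up. Qed.

Lemma flat_ext_flat F : flat M F -> flat N (ext_flat F).
Proof.
move=> fF; split=> [u []//|u gu nFu]; apply: rho_lt; [exact: ncut_above..| |].
  by apply: aboveS => v; right.
move=> e; apply: nFu; split=> //.
have : flats_above (ext_flat F) F by rewrite above_ext_flat//; exact: up_refl.
by rewrite -e => -[_]; apply=> //; left.
Qed.

Lemma flat_extE X : flat N X -> forall u, ext_ground u ->
  flats_above X `<=` flats_through u -> X u.
Proof.
move=> [_ fX] u gu Xu; apply: contrapT => nXu; have := fX u gu nXu.
suff: ext_rk (u |` X) <= ext_rk X by rewrite /=; lia.
apply: rho_mono; [exact: ncut_above..|].
by move=> F XF; split=> [|v]; [case: XF|case=> [->|Xv] gv;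
  [exact: Xu|case: XF => _; apply]].
Qed.

Lemma flat_ext_up X F : flat N X -> flat M F -> flats_above X = up M F ->
  X = ext_flat F.
Proof.
move=> fX fF XF; apply/seteqP; split=> u.
  move=> Xu; have gu := flat_sub fX Xu; split=> //.
  have : flats_above X F by rewrite XF; exact: up_refl.
  by case=> _; apply.
move=> [gu Fu]; apply: flat_extE => //; rewrite XF.
exact: cut_up (ncut_through gu).1 Fu.
Qed.

(** A flat is determined by the cut above it: a principal cut gives an extended flat of [M], a
    nonprincipal one has rank 1. Hence lines and planes are all old. *)
Lemma flat_extP X : flat N X ->
  (exists2 F, flat M F & X = ext_flat F) \/ rk N X = 1.
Proof.
move=> fX; case: (ncutP (ncut_above X)) => [bX|[F fF XF]].
  by right; exact: rho_bundle.
by left; exists F => //; exact: flat_ext_up.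
Qed.

Lemma above_ext_flatU F G : flat M F -> flat M G ->
  flats_above (ext_flat F `|` ext_flat G) = up M (cl M (F `|` G)).
Proof.
move=> fF fG; rewrite aboveU !above_ext_flat//.
have uE : F `|` G `<=` ground M by rewrite subUset; split; exact: flat_sub.
apply/seteqP; split=> H.
  move=> [[fH FH] [_ GH]]; split=> //; apply: cl_min => //.
  by rewrite subUset.
move=> [fH FGH]; have := subset_trans (sub_cl uE) FGH.
by rewrite subUset => -[FH GH].
Qed.

Lemma rk_ext_flatU F G : flat M F -> flat M G ->
  rk N (ext_flat F `|` ext_flat G) = rk M (F `|` G).
Proof.
move=> fF fG; rewrite /= /ext_rk above_ext_flatU// rho_up ?rk_cl//.
exact: flat_cl.
Qed.

(** The closure axiom of modular cuts is exactly what sends a new point on both flats to their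
    intersection; for a nonmodular pair, such a point may be genuinely additional. *)
Lemma ext_flatI F G : flat M F -> flat M G -> modular_pair M F G ->
  ext_flat F `&` ext_flat G = ext_flat (F `&` G).
Proof.
move=> fF fG mp; apply/seteqP; split=> u.
  move=> [[gu uF] [_ uG]]; split=> //;
    exact: cut_cap (ncut_through gu).1 uF uG mp.
move=> [gu uFG]; have [mu _] := ncut_through gu.
by split; split=> //; apply: (cut_up mu uFG); split=> // x [].
Qed.

Lemma modular_pair_ext F G : flat M F -> flat M G -> modular_pair M F G ->
  modular_pair N (ext_flat F) (ext_flat G).
Proof.
move=> fF fG mp; rewrite /modular_pair rk_ext_flatU// ext_flatI//.
by rewrite !rk_ext_flat//; exact: flat_cap.
Qed.

Lemma rk_ext_ground : rank N = 4.
Proof.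
rewrite -rM; apply/eqP; rewrite eqn_leq; apply/andP; split.
  by rewrite rM; exact: ext_rk_le4.
rewrite /rank -ext_rk_inl; apply: ext_rk_mono => _ [x Ex <-]; exact: Ex.
Qed.

Lemma ext_OTE : OTE N.
Proof.
move=> D mD nD; have D1 X : D X -> rk N X <= 1 -> principal N D.
  by move=> DX; exact: cut_rk1 DX.
have [[X [DX rX]]|nX] := EM (exists X, D X /\ rk N X <= 1);
  first exact: D1 DX rX.
have Dext X : D X -> exists2 F, flat M F & X = ext_flat F.
  move=> DX; have fX := cut_flat mD DX.
  have [//|r1] := flat_extP fX.
  by case: nX; exists X; rewrite r1.
pose C := [set F | flat M F /\ D (ext_flat F)].
have mC : modular_cut M C.
  split=> [F []//|F G [fF DF] fG FG|F G [fF DF] [fG DG] mp].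
    split=> //; apply: (cut_up mD DF); split; first exact: flat_ext_flat.
    move=> u [gu uF]; split=> //; exact: (cut_up (ncut_through gu).1 uF).
  split; first exact: flat_cap.
  by rewrite -ext_flatI//; apply: (cut_cap mD DF DG); exact: modular_pair_ext.
have nC : C !=set0.
  by case: nD => X DX; have [F fF XF] := Dext _ DX; exists F; split;
    rewrite -?XF.
have [bC|[F fF CF]] := ncutP (conj mC nC).
  have [l1 [l2 [C1 C2 r1 r2 l12]]] := bundle_lines hypM rM bC.
  have [f1 d1] := C1; have [f2 d2] := C2.
  have r3 := bundle_coplanar bC C1 C2 r1 r2 l12.
  have := rk_submod N (ext_flat l1) (ext_flat l2).
  rewrite rk_ext_flatU// !rk_ext_flat// r1 r2 r3 => rI.
  (* If the trace [C] were nonprincipal, the new point [inr C] would lie on both extended lines.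
     These have ranks 2 and 2 and span rank 3, so they become a modular pair and [D] acquires a
     member of rank 1. *)
  have r1' : 1 <= rk N (ext_flat l1 `&` ext_flat l2).
    rewrite /= -(rho_bundle bC); apply: rho_mono;
      [exact: ncut_above|exact: ncut_bundle|].
    by move=> F [_ /(_ (inr C)) h]; apply: h => //; split; split.
  case: nX; exists (ext_flat l1 `&` ext_flat l2); split; last by lia.
  apply: (cut_cap mD d1 d2);
    rewrite /modular_pair rk_ext_flatU// !rk_ext_flat//; lia.
have [_ DF] : C F by rewrite CF; exact: up_refl.
rewrite (principalP mD DF); first exact/principal_up/flat_ext_flat.
move=> X DX; have [G fG XG] := Dext _ DX.
have : C G by split=> //; rewrite -XG.
rewrite CF XG => -[_ FG] u [gu uF]; split=> //.
exact: (cut_up (ncut_through gu).1 uF).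
Qed.

Lemma ext_embedding : embedding M N inl.
Proof.
have sub : inl @` ground M `<=` ground N by move=> _ [x Ex <-].
split=> //; split; first split.
- by move=> x Ex; split; [exact: Ex|exists x].
- by move=> x y _ _ [].
- by move=> _ [_ [x Ex <-]]; exists x.
move=> X XE; rewrite /= /restrict_rk (setIidl (image_subset _ XE)).
exact: ext_rk_inl.
Qed.

Lemma ext_flat_preimage F : flat M F -> inl @^-1` ext_flat F = F.
Proof.
move=> fF; apply/seteqP; split=> x; first by case=> _ [].
by move=> Fx; split; [exact: flat_sub Fx|].
Qed.

Lemma ext_line L : line N L ->
  exists l, [/\ flat M l, rk M l = 2 & L = ext_flat l].
Proof.
move=> [fL rL]; have [[l fl Ll]|] := flat_extP fL; last by rewrite rL.
by exists l; rewrite -(rk_ext_flat fl) -Ll.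
Qed.

(** New points are sets of subsets of the ground set, so they lie in a double power set. *)
Lemma ext_finite : finite_set (ground N) <-> finite_set (ground M).
Proof.
split=> [fN|fM].
  rewrite (_ : ground M = inl @^-1` ground N)//.
  by apply: finite_preimage fN => x y _ _ [].
have finC : finite_set [set C | C `<=` [set F | F `<=` ground M]].
  by do 2! apply: finite_powerset.
apply: (@sub_finite_set _ _ (inl @` ground M `|` inr @` [set C | C `<=` [set F
  | F `<=` ground M]])).
  case=> [e Ee|C bC]; first by left; exists e.
  by right; exists C => // F CF; exact/flat_sub/(bundle_flat bC).
by rewrite finite_setU; split; exact: finite_image.
Qed.

End Extension.

(** * The bundle condition *)

Section BundleCondition.
Context {T : Type} (M : matroid T).
Context (hypM : hypermodular M) (rM : rank M = 4).
Implicit Types (F G P Q a b c l m n p q s : set T).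

Definition disj_coplanar l m : Prop := rk M (l `|` m) = 3 /\ rk M (l `&` m) = 0.

Lemma disj_coplanarC l m : disj_coplanar l m -> disj_coplanar m l.
Proof. by rewrite /disj_coplanar setUC setIC. Qed.

Lemma disj_notin l m x : rk M (l `&` m) = 0 -> rk M [set x] = 1 -> l x -> ~ m x.
Proof.
move=> r0 rx lx mx; suff : rk M [set x] <= rk M (l `&` m) by lia.
by apply: rk_mono => _ ->.
Qed.

Lemma plane_eq P Q l x : flat M P -> flat M Q -> rk M P = 3 -> rk M Q = 3 ->
  line M l -> l `<=` P -> l `<=` Q -> P x -> Q x -> ~ l x -> P = Q.
Proof.
move=> fP fQ rP rQ [fl rl] lP lQ Px Qx lx.
have rxl : rk M (x |` l) = 3 by rewrite (flat_rkU1 fl (flat_sub fP Px) lx) rl.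
have span R : flat M R -> rk M R = 3 -> l `<=` R -> R x -> R = cl M (x |` l).
  by move=> fR rR lR Rx; apply: flat_spanned; rewrite ?rxl ?rR// => y [->|/lR].
by rewrite (span P)// (span Q).
Qed.

Lemma plane_of_disj l m : line M l -> line M m -> disj_coplanar l m ->
  [/\ flat M (cl M (l `|` m)), rk M (cl M (l `|` m)) = 3,
      l `<=` cl M (l `|` m) & m `<=` cl M (l `|` m)].
Proof.
move=> [fl _] [fm _] [r3 _]; rewrite rk_cl.
have uE : l `|` m `<=` ground M by rewrite subUset; split; exact: flat_sub.
split=> //; first exact: flat_cl.
  by apply: subset_trans (sub_cl uE); exact: subsetUl.
by apply: subset_trans (sub_cl uE); exact: subsetUr.
Qed.

(** The nonloop [x] of [m] is off [l], so [l] and [x] already span the plane of [l] and [m]. *)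
Lemma disj_sub_plane l m x P : line M l -> line M m -> disj_coplanar l m ->
  flat M P -> l `<=` P -> P x -> m x -> rk M [set x] = 1 -> m `<=` P.
Proof.
move=> Ll Lm cd fP lP Px mx rx; have [fl rl] := Ll.
have lx : ~ l x by move=> lx; apply: disj_notin cd.2 rx lx mx.
have [fQ rQ lQ mQ] := plane_of_disj Ll Lm cd.
have [fR rR lR Rx] := plane_of fl rl (flat_sub fP Px) lx.
apply: (subset_trans mQ);
  rewrite (plane_eq fQ fR rQ rR Ll lQ lR (mQ _ mx) Rx lx).
by apply: cl_min => // y [->|/lP].
Qed.

(** Only the triples containing both [p] and [q] need a hypothesis: a plane containing [m] and [n]
    would already make them coplanar. *)
Lemma bundle_condition4 p q m n : bundle_condition M ->
  line M p -> line M q -> line M m -> line M n ->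
  disj_coplanar p q -> disj_coplanar p m -> disj_coplanar p n ->
  disj_coplanar q m -> disj_coplanar q n -> rk M (m `&` n) = 0 ->
  rk M (p `|` q `|` m) <> 3 -> rk M (p `|` q `|` n) <> 3 ->
  rk M (m `|` n) = 3.
Proof.
move=> bc Lp Lq Lm Ln pq pm pn qm qn mn0 pqm pqn.
apply: contrapT => mn3.
have mn_lt X : m `|` n `<=` X -> rk M X <> 3.
  move=> mnX rX; apply: mn3; apply/eqP; rewrite eqn_leq -{1}rX rk_mono//=.
  have := flat_rkU Lm.1 (flat_sub Ln.1); rewrite Lm.2; apply=> nm.
  by move: mn0; rewrite (setIidr nm) Ln.2.
pose f (i : 'I_4) := nth set0 [:: p; q; m; n] i.
have i2 : 2 < 4 by []. have i3 : 3 < 4 by [].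
have := bc f _ _ _ _ (Ordinal i2) (Ordinal i3) isT; rewrite /coplanar /f /=.
move=> H; apply: mn3; apply: H.
- by case=> [[|[|[|[|]]]]].
- case=> [[|[|[|[|i]]]] Hi] // [[|[|[|[|j]]]] Hj] //= _;
    rewrite /disjoint_flats;
    by [case: pq|case: pm|case: pn|case: qm|case: qn|].
- case=> [[|[|[|[|i]]]] Hi] // [[|[|[|[|j]]]] Hj] // [[|[|[|[|k]]]] Hk] //= _ _;
    rewrite /coplanar3 => //;
    apply: mn_lt => y /=; tauto.
- exists (Ordinal i2), (Ordinal i3); split=> //.
  case=> [[|[|[|[|i]]]] Hi] // [[|[|[|[|j]]]] Hj] //= _ ne;
    try by [case: pq|case: pm|case: pn|case: qm|case: qn].
  by case: ne; congr (_, _); apply: val_inj.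
Qed.

(** * The bundle generated by three lines *)

Definition lines3 p q s := [/\ line M p, line M q & line M s] /\
  [/\ disj_coplanar p q, disj_coplanar p s, disj_coplanar q s &
      rk M (p `|` q `|` s) = 4].

Lemma lines3_rot p q s : lines3 p q s -> lines3 p s q.
Proof.
move=> [[? ? ?] [? ? ? r4]]; split; split=> //; first exact: disj_coplanarC.
by rewrite -r4 setUAC.
Qed.

Notation pl x l := (cl M (x |` l)).

(** This is the only candidate for the line joining [x] to the missing point of [p] and [q]. If it
    met [p] in a nonloop, the plane of [x] and [q] would contain [p], and the two planes would
    agree. *)
Lemma plane_cap_disj x p q : line M p -> line M q -> disj_coplanar p q ->
  ground M x -> ~ p x -> ~ q x -> pl x p <> pl x q ->
  line M (pl x p `&` pl x q) /\ disj_coplanar (pl x p `&` pl x q) p.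
Proof.
move=> Lp Lq pq Ex px qx npq.
have [fP rP pP Px] := plane_of Lp.1 Lp.2 Ex px.
have [fQ rQ qQ Qx] := plane_of Lq.1 Lq.2 Ex qx.
have [mp r2] := plane_cap hypM rM fP fQ rP rQ npq.
have Lm : line M (pl x p `&` pl x q) by split=> //; exact: flat_cap.
split=> //; split.
  apply/eqP; rewrite eqn_leq; apply/andP; split.
    by apply: (leq_trans _ (eq_leq rP)); apply: rk_mono; rewrite subUset;
      split=> //; exact: subIsetl.
  by rewrite -Lp.2 setUC; apply: (flat_rkU Lp.1 (flat_sub Lm.1)) => h;
    apply/px/h; split.
apply/eqP; rewrite -leqn0 leqNgt; apply/negP => /nonloop_in[w [[_ Qw] pw] rw].
apply: npq; have pQ := disj_sub_plane Lq Lp (disj_coplanarC pq) fQ qQ Qw pw rw.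
exact: (plane_eq fP fQ rP rQ Lp pP pQ Px Qx px).
Qed.

Lemma lines3_planes p q s x : lines3 p q s -> ground M x ->
  ~ p x -> ~ q x -> ~ s x -> pl x p = pl x q -> pl x p = pl x s -> False.
Proof.
move=> [[[fp rp] [fq rq] [fs rs]] [_ _ _ r4]] Ex px qx sx pq ps.
have [fP rP pP Px] := plane_of fp rp Ex px.
have [_ _ qP _] := plane_of fq rq Ex qx.
have [_ _ sP _] := plane_of fs rs Ex sx.
suff : rk M (p `|` q `|` s) <= rk M (pl x p) by lia.
by apply: rk_mono; rewrite !subUset; split; [split|rewrite ps]=> //; rewrite pq.
Qed.

(** The line [m] common to the planes of [x] with [p] and with [q] is disjoint from [s]: a common
    nonloop would put [s] into both planes and force [s = m], which contains [x]. The bundle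
    condition for [p], [q], [s], [m] then yields the sixth coplanar pair. *)
Lemma lines3_through_aux p q s x : bundle_condition M -> lines3 p q s ->
  ground M x -> ~ p x -> ~ q x -> ~ s x -> pl x p <> pl x q ->
  exists m, [/\ line M m, m x, disj_coplanar m p, disj_coplanar m q &
                disj_coplanar m s].
Proof.
move=> bc [[Lp Lq Ls] [pq ps qs r4]] Ex px qx sx npq.
have [Lm mp] := plane_cap_disj Lp Lq pq Ex px qx npq.
have [_ mq] := plane_cap_disj Lq Lp (disj_coplanarC pq) Ex qx px (nesym npq).
rewrite setIC in mq.
have [fP rP pP Px] := plane_of Lp.1 Lp.2 Ex px.
have [fQ rQ qQ Qx] := plane_of Lq.1 Lq.2 Ex qx.
set m := pl x p `&` pl x q in Lm mp mq.
have ms0 : rk M (m `&` s) = 0.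
  apply/eqP; rewrite -leqn0 leqNgt;
    apply/negP => /nonloop_in[w [[Pw Qw] sw] rw].
  have sP := disj_sub_plane Lp Ls ps fP pP Pw sw rw.
  have sQ := disj_sub_plane Lq Ls qs fQ qQ Qw sw rw.
  apply: sx; rewrite (_ : s = m)//.
  apply: (flat_eq Ls.1 _ (flat_sub Lm.1)); first by rewrite subsetI.
  by rewrite Lm.2 Ls.2.
exists m; split=> //; split=> //; rewrite setUC.
apply: (bundle_condition4 bc Lp Lq Ls Lm) => //; try exact: disj_coplanarC.
- by rewrite setIC.
- by rewrite r4.
move=> r3; apply: npq.
have uE : p `|` q `|` m `<=` ground M.
  by rewrite !subUset; split; [split|]; apply: flat_sub;
    [exact: Lp.1|exact: Lq.1|exact: Lm.1].
have fR := flat_cl M (p `|` q `|` m); have uR := sub_cl uE.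
have rR : rk M (cl M (p `|` q `|` m)) = 3 by rewrite rk_cl.
have pR : p `<=` cl M (p `|` q `|` m) by move=> y py; apply: uR; left; left.
have qR : q `<=` cl M (p `|` q `|` m) by move=> y qy; apply: uR; left; right.
have Rx : cl M (p `|` q `|` m) x by apply: uR; right.
by rewrite (plane_eq fP fR rP rR Lp pP pR Px Rx px) (plane_eq fQ fR rQ rR Lq
  qQ qR Qx Rx qx).
Qed.

Section Family.
Context (bc : bundle_condition M) a b c (abc : lines3 a b c).

Definition eq_or_disj l m := l = m \/ disj_coplanar l m.

(** The lines of the bundle generated by three lines that are pairwise disjoint
    and coplanar but not all in a plane. *)
Definition family m :=
  [/\ line M m, eq_or_disj m a, eq_or_disj m b & eq_or_disj m c].

Lemma family_through x : ground M x -> exists2 m, family m & m x.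
Proof.
move=> Ex; have [[La Lb Lc] [ab ac bc' r4]] := abc.
have [ax|ax] := EM (a x).
  by exists a => //; split=> //; [left|right|right].
have [bx|bx] := EM (b x).
  by exists b => //; split=> //; [right; exact: disj_coplanarC|left|right].
have [cx|cx] := EM (c x).
  by exists c => //; split=> //; [right; exact: disj_coplanarC..|left].
(* The planes of [x] with [a], [b] and [c] cannot all coincide, as they would contain three lines of
   total rank 4; some two of them are distinct. *)
have [Pab|Pab] := EM (pl x a = pl x b).
  have Pac : pl x a <> pl x c.
    by move=> Pac; apply: lines3_planes abc Ex ax bx cx Pab Pac.
  have [m [Lm mx ma mc mb]] := lines3_through_aux bc (lines3_rot abc) Ex ax cx
    bx Pac.
  by exists m => //; split=> //; right.
have [m [Lm mx ma mb mc]] := lines3_through_aux bc abc Ex ax bx cx Pab.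
by exists m => //; split=> //; right.
Qed.

Lemma eq_or_disj_at m l x : eq_or_disj m l -> rk M [set x] = 1 -> m x ->
  l x -> m = l.
Proof. by case=> // -[_ r0] rx mx /(disj_notin r0 rx mx). Qed.

Lemma disj_at m l x : eq_or_disj m l -> m x -> ~ l x -> disj_coplanar m l.
Proof. by case=> // <-. Qed.

Lemma line_plane_cap m p q x : line M m -> line M p -> line M q ->
  disj_coplanar m p -> disj_coplanar m q -> rk M [set x] = 1 -> m x ->
  ~ p x -> ~ q x -> pl x p <> pl x q -> m = pl x p `&` pl x q.
Proof.
move=> Lm Lp Lq mp mq rx mx px qx npq; have Ex := nonloop_ground rx.
have [fP rP pP Px] := plane_of Lp.1 Lp.2 Ex px.
have [fQ rQ qQ Qx] := plane_of Lq.1 Lq.2 Ex qx.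
have [_ r2] := plane_cap hypM rM fP fQ rP rQ npq.
apply: (flat_eq Lm.1); last by rewrite r2 Lm.2.
  rewrite subsetI; split.
    exact: disj_sub_plane Lp Lm (disj_coplanarC mp) fP pP Px mx rx.
  exact: disj_sub_plane Lq Lm (disj_coplanarC mq) fQ qQ Qx mx rx.
exact/flat_sub/flat_cap.
Qed.

Lemma family_uniq m n x : family m -> family n -> rk M [set x] = 1 ->
  m x -> n x -> m = n.
Proof.
move=> [Lm ma mb mc] [Ln na nb nc] rx mx nx; have Ex := nonloop_ground rx.
have [[La Lb Lc] [ab ac bc' r4]] := abc.
have [ax|ax] := EM (a x).
  by rewrite (eq_or_disj_at ma rx mx ax) (eq_or_disj_at na rx nx ax).
have [bx|bx] := EM (b x).
  by rewrite (eq_or_disj_at mb rx mx bx) (eq_or_disj_at nb rx nx bx).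
have [cx|cx] := EM (c x).
  by rewrite (eq_or_disj_at mc rx mx cx) (eq_or_disj_at nc rx nx cx).
have {}ma := disj_at ma mx ax; have {}mb := disj_at mb mx bx.
have {}mc := disj_at mc mx cx; have {}na := disj_at na nx ax.
have {}nb := disj_at nb nx bx; have {}nc := disj_at nc nx cx.
have [Pab|Pab] := EM (pl x a = pl x b).
  have Pac : pl x a <> pl x c.
    by move=> Pac; apply: lines3_planes abc Ex ax bx cx Pab Pac.
  by rewrite (line_plane_cap Lm La Lc ma mc rx mx ax cx Pac)
             -(line_plane_cap Ln La Lc na nc rx nx ax cx Pac).
by rewrite (line_plane_cap Lm La Lb ma mb rx mx ax bx Pab)
           -(line_plane_cap Ln La Lb na nb rx nx ax bx Pab).
Qed.

(** Two planes that both contain [m] and [q] span rank 3 only, while their union contains three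
    lines of rank 4. *)
Lemma lines3_pair p q s m : lines3 p q s -> disj_coplanar m q ->
  rk M (p `|` q `|` m) = 3 -> rk M (q `|` s `|` m) = 3 -> False.
Proof.
move=> [_ [_ _ _ r4]] [mq _] r1 r2.
have mq1 : m `|` q `<=` p `|` q `|` m by move=> x /=; tauto.
have mq2 : m `|` q `<=` q `|` s `|` m by move=> x /=; tauto.
have := rkUZ M mq1 mq2; rewrite mq r1 r2.
suff : rk M (p `|` q `|` s) <= rk M ((p `|` q `|` m) `|` (q `|` s `|` m)).
  by lia.
by apply: rk_mono => x /=; tauto.
Qed.

(** Each of [m] and [n] is coplanar as a triple with at most one of the three pairs from [a], [b],
    [c]. Some pair is therefore good for both, and the bundle condition applies to it together with
    [m] and [n]. *)
Lemma family_coplanar m n : family m -> family n -> m <> n -> disj_coplanar m n.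
Proof.
move=> Fm Fn mn; have [Lm ma mb mc] := Fm; have [Ln na nb nc] := Fn.
have [[La Lb Lc] [ab ac bc' r4]] := abc.
have mn0 : rk M (m `&` n) = 0.
  apply/eqP; rewrite -leqn0 leqNgt; apply/negP => /nonloop_in[w [mw nw] rw].
  exact/mn/(family_uniq Fm Fn rw).
split=> //.
have swap l : eq_or_disj m l -> eq_or_disj n l -> (m = l \/ n = l) ->
  rk M (m `|` n) = 3.
  move=> em en [ml|nl].
    by case: en => [nl|[nl _]]; [case: mn; rewrite ml nl|rewrite ml setUC].
  by case: em => [ml|[ml _]]; [case: mn; rewrite ml nl|rewrite nl].
have [|na'] := EM (m = a \/ n = a); first exact: swap.
have [|nb'] := EM (m = b \/ n = b); first exact: swap.
have [|nc'] := EM (m = c \/ n = c); first exact: swap.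
have {}ma : disj_coplanar m a by case: ma => // ?; case: na'; left.
have {}mb : disj_coplanar m b by case: mb => // ?; case: nb'; left.
have {}mc : disj_coplanar m c by case: mc => // ?; case: nc'; left.
have {}na : disj_coplanar n a by case: na => // ?; case: na'; right.
have {}nb : disj_coplanar n b by case: nb => // ?; case: nb'; right.
have {}nc : disj_coplanar n c by case: nc => // ?; case: nc'; right.
have good p q : line M p -> line M q -> disj_coplanar p q ->
    disj_coplanar m p -> disj_coplanar m q -> disj_coplanar n p ->
      disj_coplanar n q ->
    rk M (p `|` q `|` m) <> 3 -> rk M (p `|` q `|` n) <> 3 ->
      rk M (m `|` n) = 3.
  move=> Lp Lq pq mp mq np nq; apply: bundle_condition4 => //;
    exact: disj_coplanarC.
have H1 := good _ _ La Lb ab ma mb na nb.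
have H2 := good _ _ Lb Lc bc' mb mc nb nc.
have H3 := good _ _ La Lc ac ma mc na nc.
have K12 l : disj_coplanar l b -> rk M (a `|` b `|` l) = 3 ->
  rk M (b `|` c `|` l) = 3 -> False.
  exact: lines3_pair abc.
have K23 l : disj_coplanar l c -> rk M (b `|` c `|` l) = 3 ->
  rk M (a `|` c `|` l) = 3 -> False.
  move=> lc; rewrite (setUC b c) => r1 r2.
  exact: lines3_pair (lines3_rot abc) lc r2 r1.
have K13 l : disj_coplanar l a -> rk M (a `|` b `|` l) = 3 ->
  rk M (a `|` c `|` l) = 3 -> False.
  move=> la; rewrite (setUC a b) => r1 r2.
  apply: (lines3_pair _ la r1 r2).
  split; split=> //; first exact: disj_coplanarC.
  by rewrite -r4 (setUC b a).
have := K12 m mb; have := K12 n nb; have := K23 m mc; have := K23 n nc.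
have := K13 m ma; have := K13 n na.
have := EM (rk M (a `|` b `|` m) = 3); have := EM (rk M (a `|` b `|` n) = 3).
have := EM (rk M (b `|` c `|` m) = 3); have := EM (rk M (b `|` c `|` n) = 3).
have := EM (rk M (a `|` c `|` m) = 3); have := EM (rk M (a `|` c `|` n) = 3).
clear -H1 H2 H3; tauto.
Qed.

Lemma family_sub m n F x : family m -> family n -> flat M F -> m `<=` F ->
  F x -> n x -> rk M [set x] = 1 -> n `<=` F.
Proof.
move=> Fm Fn fF mF Fx nx rx; have [<-//|mn] := EM (m = n).
have cd := family_coplanar Fm Fn mn; have [Lm _ _ _] := Fm;
  have [Ln _ _ _] := Fn.
exact: disj_sub_plane Lm Ln cd fF mF Fx nx rx.
Qed.

Lemma family_bundle :
  bundle M [set F | flat M F /\ exists2 m, family m & m `<=` F].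
Proof.
have [[La Lb Lc] [ab ac bc' r4]] := abc.
have Fa : family a by split=> //; [left|right|right].
have Fb : family b by split=> //; [right; exact: disj_coplanarC|left|right].
split; first split.
- by move=> F [].
- move=> F G [fF [m Fm mF]] fG FG; split=> //; exists m => //.
  exact: subset_trans FG.
- move=> F G [fF [m Fm mF]] [fG [n Fn nG]] mp; split; first exact: flat_cap.
  (* If [F] and [G] share a nonloop, the family line through it lies in both. Otherwise the coplanar
     lines [m] and [n] make the union too small: its rank is at most that of [F] plus 1 plus that of
     [G] minus 2, against modularity. *)
  have [r0|] := posnP (rk M (F `&` G)); last first.
    move=> /nonloop_in[x [Fx Gx] rx].
    have [k Fk kx] := family_through (nonloop_ground rx).
    exists k => //; rewrite subsetI; split.
      exact: family_sub Fm Fk fF mF Fx kx rx.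
    exact: family_sub Fn Fk fG nG Gx kx rx.
  have [[fm rm] _ _ _] := Fm; have [[fn rn] _ _ _] := Fn.
  have [mn|mn] := EM (m = n).
    suff : rk M m <= rk M (F `&` G) by lia.
    by apply: rk_mono; rewrite subsetI; split=> //; rewrite mn.
  have [r3 _] := family_coplanar Fm Fn mn.
  have h1 := @rkUZ _ M F (m `|` n) m mF (@subsetUl _ _ _).
  have h2 := @rkUZ _ M (F `|` (m `|` n)) G n _ nG.
  have /h2{}h2 : n `<=` F `|` (m `|` n) by move=> y ?; right; right.
  have : rk M (F `|` G) <= rk M (F `|` (m `|` n) `|` G).
    by apply: rk_mono => y [Fy|Gy]; [left; left|right].
  by move: mp; rewrite /modular_pair; lia.
- by exists a; split; [exact: La.1|exists a].
(* A generator would contain a family line and lie in both [a] and [b], whose intersection has rank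
   0. *)
- move=> [F fF CF].
  have Ca : up M F a.
    by rewrite /up -CF; split; [exact: La.1|exists a].
  have Cb : up M F b.
    by rewrite /up -CF; split; [exact: Lb.1|exists b].
  have : up M F F by exact: up_refl.
  rewrite /up -CF => -[_ [m [[_ rm] _ _ _] mF]].
  suff : rk M m <= rk M (a `&` b) by rewrite ab.2; lia.
  apply: rk_mono; apply: (subset_trans mF).
  by rewrite subsetI; case: Ca; case: Cb.
Qed.

End Family.

(** A point [x] off the plane of [a] and [b] supplies the third line [c], common to the planes of
    [x] with [a] and with [b]. *)
Lemma bundle_of_lines a b : bundle_condition M -> line M a -> line M b ->
  disj_coplanar a b -> exists C, [/\ bundle M C, C a & C b].
Proof.
move=> bc La Lb ab; have [fH rH aH bH] := plane_of_disj La Lb ab.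
have [x Ex Hx] : exists2 x, ground M x & ~ cl M (a `|` b) x.
  by apply: notin_of_rk; rewrite rH rM.
have ax : ~ a x by move=> /aH. have bx : ~ b x by move=> /bH.
have [fP rP aP Px] := plane_of La.1 La.2 Ex ax.
have [fQ rQ bQ Qx] := plane_of Lb.1 Lb.2 Ex bx.
have Pab : pl x a <> pl x b.
  move=> Pab; apply: Hx;
    rewrite (@flat_spanned _ M (a `|` b) (pl x a)) ?rP// in Px.
    by rewrite subUset; split=> //; rewrite Pab.
  by rewrite ab.1.
have [Lc ca] := plane_cap_disj La Lb ab Ex ax bx Pab.
have [_ cb] := plane_cap_disj Lb La (disj_coplanarC ab) Ex bx ax (nesym Pab).
rewrite setIC in cb; set c := _ `&` _ in Lc ca cb.
have abc : lines3 a b c.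
  split; split=> //; try exact: disj_coplanarC.
  have uE : a `|` b `|` c `<=` ground M.
    by rewrite !subUset; split; [split|]; apply: flat_sub;
      [exact: La.1|exact: Lb.1|exact: Lc.1].
  apply/eqP; rewrite eqn_leq flat_rk4//= ltnNge; apply/negP => r3; apply: Hx.
  rewrite (@flat_eq _ M (cl M (a `|` b)) (cl M (a `|` b `|` c)))//.
  - by apply: sub_cl => //; right.
  - apply: subset_cl => //; exact: subsetUl.
  - exact: cl_ground.
  - by rewrite rH rk_cl.
exists [set F | flat M F /\ exists2 m, family a b c m & m `<=` F]; split.
- exact: family_bundle.
- split; first exact: La.1.
  exists a => //; split=> //; [by left|right=> //|right; exact: disj_coplanarC].
- split; first exact: Lb.1.
  by exists b => //; split=> //; [right; exact: disj_coplanarC|left|right;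
    exact: disj_coplanarC].
Qed.

(** Two planes are always modular, so [F] is a line and [G] a line or a plane disjoint from it; the
    modular defect is 1, exactly what one shared new point repairs. *)
Lemma nonmodular_bundle F G : bundle_condition M -> flat M F -> flat M G ->
  1 < rk M F -> rk M F <= rk M G -> ~ modular_pair M F G ->
  rk M F + rk M G <= (rk M (F `|` G)).+1 /\
  exists C, [/\ bundle M C, C F & C G].
Proof.
move=> bc fF fG rF rFG nm.
have FG : ~ F `<=` G by move/(modular_pair_sub M).
have rG4 : rk M G < 4.
  rewrite ltnNge; apply/negP => r4; apply: FG.
  by rewrite (flat_rk4_eq rM fG r4); exact: flat_sub.
have rU := flat_rkU fG (flat_sub fF) FG; rewrite setUC in rU.
have rI := rk_submod M F G.
have uE : F `|` G `<=` ground M by rewrite subUset; split; exact: flat_sub.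
have rU4 := flat_rk4 rM uE.
have nFG : F <> G by move=> e; apply: FG; rewrite e.
have [[F3 G3]|n3] := EM (rk M F = 3 /\ rk M G = 3).
  by have [] := plane_cap hypM rM fF fG F3 G3 nFG.
have F2 : rk M F = 2 by lia.
have LF : line M F by [].
move: nm; rewrite /modular_pair => nm; split; first lia.
have r0 : rk M (F `&` G) = 0 by lia.
have [G2|G2] := EM (rk M G = 2).
  by apply: bundle_of_lines => //; split=> //; lia.
have G3 : rk M G = 3 by lia.
(* A plane [G] is traded for the line it shares with the plane of [F] and a nonloop of [G]. *)
have [x Gx rx] : exists2 x, G x & rk M [set x] = 1 by apply: nonloop_in; lia.
have Fx : ~ F x by move=> Fx; apply: disj_notin r0 rx Fx Gx.
have [fP rP FP Px] := plane_of fF F2 (flat_sub fG Gx) Fx.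
have PG : pl x F <> G by move=> PG; apply: FG; rewrite -PG.
have [_ r2] := plane_cap hypM rM fP fG rP G3 PG.
have Ll : line M (pl x F `&` G) by split=> //; exact: flat_cap.
have cd : disj_coplanar F (pl x F `&` G).
  split; apply/eqP.
    rewrite eqn_leq; apply/andP; split.
      by apply: (leq_trans _ (eq_leq rP)); apply: rk_mono; rewrite subUset;
        split=> //; exact: subIsetl.
    by rewrite -F2; apply: (flat_rkU fF (flat_sub Ll.1)) => /(_ x) h;
      apply/Fx/h.
  by rewrite -leqn0 -r0; apply: rk_mono => y [Fy [_ Gy]].
have [C [bC CF Cl]] := bundle_of_lines bc LF Ll cd.
by exists C; split=> //; apply: (bundle_up bC Cl fG); exact: subIsetr.
Qed.

Lemma extension_modular : bundle_condition M -> modular (extension hypM rM).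
Proof.
move=> bc X Y fX fY.
have [rX|rX] := leqP (rk (extension hypM rM) X) 1.
  exact: modular_pair_rk1 (flat_sub fX) fY rX.
have [rY|rY] := leqP (rk (extension hypM rM) Y) 1.
  exact/modular_pairC/(modular_pair_rk1 (flat_sub fY) fX rY).
have [[F fF XF]|X1] := flat_extP fX; last by move: rX; rewrite X1.
have [[G fG YG]|Y1] := flat_extP fY; last by move: rY; rewrite Y1.
rewrite XF YG in rX rY *.
move: rX rY; rewrite !rk_ext_flat// => rF rG {X Y fX fY XF YG}.
wlog FG : F G fF fG rF rG / rk M F <= rk M G.
  move=> W; have [|/ltnW] := leqP (rk M F) (rk M G); first exact: W.
  by move=> ?; apply/modular_pairC/W.
have [mp|nm] := EM (modular_pair M F G); first exact: modular_pair_ext.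
have [rFG [C [bC CF CG]]] := nonmodular_bundle bc fF fG rF FG nm.
have := rk_submod (extension hypM rM) (ext_flat M F) (ext_flat M G).
rewrite /modular_pair rk_ext_flatU// !rk_ext_flat//.
suff : 1 <= rk (extension hypM rM) (ext_flat M F `&` ext_flat M G) by lia.
rewrite /= -(rho_bundle bC).
apply: (rho_mono hypM rM (ncut_above _ _) (ncut_bundle bC)).
by move=> H [_ /(_ (inr C)) h]; apply: h => //; split; split.
Qed.

End BundleCondition.

(** * Simplified contractions *)

Lemma point_contract (T : Type) (K : matroid T) (u : T) (P : set T) :
  rk K [set u] = 1 ->
  Defs.point (contract K [set u]) P <-> ~ P u /\ line K (u |` P).
Proof.
move=> ru; have gu := nonloop_ground ru.
have cE X : rk K (u |` X) = (rk (contract K [set u]) X).+1.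
  rewrite /= /contract_rk setUC ru -subSn ?subn1//.
  by rewrite -ru; apply: rk_mono => _ ->; right.
split.
  move=> [[PE fP] rP]; split; first by move=> /PE[_]; apply.
  split; last by rewrite cE rP.
  split=> [v [->//|/PE[]//]|e ge nPe].
  rewrite setUCA !cE ltnS; apply: fP; first by split=> // eu; apply: nPe; left.
  by move=> Pe; apply: nPe; right.
move=> [Pu [[PE fP] rP]]; split; last by move: rP; rewrite cE => -[].
split=> [v Pv|e [ge eu] Pe].
  by split; [apply: PE; right|move=> vu; apply: Pu; rewrite -vu].
rewrite -ltnS -!cE setUCA; apply: fP => //.
by case=> [/eu|/Pe].
Qed.

Section Contraction.
Context {T : Type} (M : matroid T).
Context (hypM : hypermodular M) (rM : rank M = 4).

Notation N := (extension hypM rM).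

(** Points of the contractions are lines through [p] with [p] removed, and a line of the extension
    is recovered from its old points; restricting to old points is thus the bijection. *)
Lemma simplify_contract_extension p : rk M [set p] = 1 ->
  isomorphic (simplify (contract N [set inl p]))
             (simplify (contract M [set p])).
Proof.
move=> rp; have Ep := nonloop_ground rp.
have rup : rk N [set inl p] = 1 by rewrite /= -image_set1 ext_rk_inl.
pose g (P : set (T + set (set T))) : set T := inl @^-1` P.
have gU P : p |` g P = g (inl p |` P).
  by apply/seteqP; split=> x; [case=> [->|Px]|case=> [[->]|Px]];
    by [left|right].
have ptN P : Defs.point (contract N [set inl p]) P ->
    ~ P (inl p) /\ exists l, [/\ flat M l, rk M l = 2,
      inl p |` P = ext_flat M l & p |` g P = l].
  move=> /(point_contract _ rup)[Pp /ext_line[l [fl rl Pl]]]; split=> //.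
  by exists l; split=> //; rewrite gU Pl; exact: ext_flat_preimage.
have gpt P : Defs.point (contract N [set inl p]) P ->
  Defs.point (contract M [set p]) (g P).
  move=> /ptN[Pp [l [fl rl Pl gl]]]; apply/(point_contract _ rp).
  by split=> //; rewrite gl.
have UK (P : set (T + set (set T))) : ~ P (inl p) -> (inl p |` P) `\ inl p = P.
  move=> Pp; apply/seteqP; split=> u; first by case=> [[]].
  by move=> Pu; split; [right|move=> up; apply: Pp; rewrite -up].
exists g; split; first split.
- exact: gpt.
- move=> P Q /set_mem/ptN[Pp [l [_ _ Pl gl]]] /set_mem/ptN[Qp [m [_ _ Qm gm]]]
  PQ.
  have : inl p |` P = inl p |` Q by rewrite Pl Qm -gl -gm PQ.
  by move=> e; rewrite -(UK _ Pp) e (UK _ Qp).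
- move=> Q /(point_contract _ rp)[Qp [fl rl]].
  have lp : (ext_flat M (p |` Q)) (inl p) by apply: (ext_flat_inl fl);
    exists p => //; left.
  exists (ext_flat M (p |` Q) `\ inl p).
    apply/(point_contract _ rup); split; first by case=> _ /(_ erefl).
    rewrite setD1K//; split; first exact: flat_ext_flat.
    by rewrite rk_ext_flat.
  apply/seteqP; split=> x.
    by move=> [[_ [_ [xp|//]]] nxp]; case: nxp; rewrite xp.
  move=> Qx; split; last by move=> [xp]; apply: Qp; rewrite -xp.
  by apply: (ext_flat_inl fl); exists x => //; right.
move=> C CN.
pose B := \bigcup_(Q in g @` C `&` Defs.point (contract M [set p])) Q
  `|` [set p].
rewrite /= /simplify_rk /= /contract_rk rp rup; congr (_ - _).
rewrite -ext_rk_inl; congr rho; apply/seteqP; split.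
  move=> F [fF CF]; split=> // u [[P [CP ptP] Pu]|->] gu; last first.
    have pB : (inl @` B) (inl p : T + set (set T)) by exists p => //; right.
    exact: CF pB Ep.
  have [Pp [l [fl rl Pl gl]]] := ptN _ ptP.
  (* The cut of [u] contains [l], hence every flat above [l]: new points impose nothing beyond the
     old points of their lines, so the ranks agree. *)
  have [_ lu] : ext_flat M l u by rewrite -Pl; right.
  apply: (cut_up (ncut_through gu).1 lu); split=> // x lx.
  have xB : (inl @` B) (inl x : T + set (set T)).
    exists x => //; move: lx; rewrite -gl => -[->|gx]; [by right|left].
    by exists (g P) => //; split; [exists P|exact: gpt].
  exact: (CF _ xB (flat_sub fl lx)).2.
apply: aboveS => _ [x [[_ [[P CP <-] _] Px]|->] <-]; last by right.
by left; exists P => //; split=> //; exact: CN.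
Qed.

End Contraction.

Theorem theorem11 (T : Type) (M : matroid T) :
  countable (ground M) -> hypermodular M -> rank M = 4 ->
  exists (U : Type) (N : matroid U) (f : T -> U),
    [/\ embedding M N f,
        OTE N,
        rank N = 4
      & forall L, line N L -> line M (ground M `&` f @^-1` L)] /\
    [/\ finite_set (ground N) <-> finite_set (ground M),
        forall p, ground M p -> rk M [set p] = 1 ->
          isomorphic (simplify (contract N [set f p]))
                     (simplify (contract M [set p]))
      & bundle_condition M -> modular N].
Proof.
move=> _ hypM rM; exists (T + set (set T))%type, (extension hypM rM), inl.
split; split.
- exact: ext_embedding.
- exact: ext_OTE.
- exact: rk_ext_ground.
- move=> L /ext_line[l [fl rl ->]]; rewrite ext_flat_preimage//.
  by rewrite (setIidr (flat_sub fl)).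
- exact: ext_finite.
- by move=> p _; exact: simplify_contract_extension.
- exact: extension_modular.
Qed.
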